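(* Let $\Omega$ be a domain in $\mathbb{R}^{2}$ and $H\in C^{0}(\Omega)$. Let $\theta\in C^{0}(\Omega)$ satisfy $$\int_{\Omega}(\cos\theta,\sin\theta)\cdot\nabla\varphi+\int_{\Omega}H\varphi=0\qquad\text{for all }\varphi\in C_{0}^{\infty}(\Omega).$$ Let $\Gamma\subset\Omega$ be a ($C^{1}$ smooth) characteristic curve with unit-speed parameter $\sigma$, i.e. $\Gamma=\{(x(\sigma),y(\sigma))\}$ satisfies $$\frac{dx}{d\sigma}=\sin\theta(x(\sigma),y(\sigma)),\qquad \frac{dy}{d\sigma}=-\cos\theta(x(\sigma),y(\sigma)).$$ Then $\Gamma$ is $C^{2}$ smooth and the curvature of $\Gamma$ (along the $N^{\perp}$ direction) equals $-H$; that is, along $\Gamma$, $\theta$ is differentiable in $\sigma$ and $$\frac{d\theta}{d\sigma}=-H.$$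
   Context: $N\equiv(\cos\theta,\sin\theta)$ and $N^{\perp}\equiv(\sin\theta,-\cos\theta)$ (the rotation of $N$ by $-\pi/2$); these are $C^{0}$ vector fields on $\Omega$. A characteristic curve is an integral curve of $N^{\perp}$. Here $d\theta/d\sigma$ means the derivative of $\sigma\mapsto\theta(x(\sigma),y(\sigma))$, and $H$ in the last formula is evaluated at $(x(\sigma),y(\sigma))$. Integrals over $\Omega$ are with respect to Lebesgue measure. *)

(* Defs.v *)
From mathcomp Require Import all_boot all_order all_algebra.
From mathcomp Require Import all_classical all_reals all_analysis.
Set Implicit Arguments.
Unset Strict Implicit.
Unset Printing Implicit Defensive.
Import Order.TTheory GRing.Theory Num.Theory.
Import numFieldNormedType.Exports.
Local Open Scope classical_set_scope.
Local Open Scope ring_scope.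

(* The plane is [R * R]; its library topology (product, sup norm) is the
   Euclidean one. *)

Definition domain (R : realType) (Omega : set (R * R)) : Prop :=
  [/\ Omega !=set0, open Omega & connected Omega].

Definition dx (R : realType) (f : R * R -> R) : R * R -> R :=
  fun p => 'D_(1, 0) f p.
Definition dy (R : realType) (f : R * R -> R) : R * R -> R :=
  fun p => 'D_(0, 1) f p.

Fixpoint C_plane (R : realType) (k : nat) (f : R * R -> R) : Prop :=
  match k with
  | 0 => continuous f
  | k'.+1 => [/\ continuous f,
                 forall p, derivable f p (1, 0) /\ derivable f p (0, 1),
                 C_plane k' (dx f) & C_plane k' (dy f)]
  end.

(* Elements of C_0^oo(Omega), extended by zero to the whole plane. *)
Definition test_function (R : realType) (Omega : set (R * R))
    (phi : R * R -> R) : Prop :=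
  [/\ forall k, C_plane k phi,
      compact (closure [set p | phi p != 0]) &
      closure [set p | phi p != 0] `<=` Omega].

(* C^k on I; meant for open I, where the iterated derivatives [derive1n j f] are
   local. Differentiability is required separately because [derive1] is total. *)
Definition C_on (R : realType) (k : nat) (I : set R) (f : R -> R) : Prop :=
  (forall j s, (j < k)%N -> I s -> derivable (derive1n j f) s 1) /\
  (forall j s, (j <= k)%N -> I s -> {for s, continuous (derive1n j f)}).

(* C^1 integral curve in Omega, defined on the open interval I (possibly
   unbounded), of the field N^perp = (sin theta, - cos theta). *)
Definition characteristic_curve (R : realType) (Omega : set (R * R))
    (theta : R * R -> R) (I : set R) (x y : R -> R) : Prop :=
  [/\ [/\ I !=set0, open I & is_interval I],
      C_on 1 I x /\ C_on 1 I y,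
      forall s, I s -> Omega (x s, y s),
      forall s, I s -> is_derive s 1 x (sin (theta (x s, y s))) &
      forall s, I s -> is_derive s 1 y (- cos (theta (x s, y s)))].

(* Signed curvature of the plane curve (x, y), traversed in the direction of
   increasing parameter; it is positive when the curve turns left. *)
Definition curvature (R : realType) (x y : R -> R) (s : R) : R :=
  (derive1 x s * derive1n 2 y s - derive1 y s * derive1n 2 x s) /
  Num.sqrt (derive1 x s ^+ 2 + derive1 y s ^+ 2) ^+ 3.

(* Main.v *)
(* Let N = (cos theta, sin theta), so that div N = H weakly. Testing with tensor
   products a(x) b(y) and applying the one-variable du Bois-Reymond lemma first
   in x, then in y, turns the weak equation into the divergence identity on
   rectangles: the flux of N through the boundary is the integral of H.

   A characteristic curve is orthogonal to N, so N calibrates it: the flux of N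
   through a vertical translate of an arc is at most the length of the arc, with
   equality for the arc itself. The two fluxes differ by the integral of H over
   the strip between the arcs, up to the flux through the two vertical sides,
   that is, the integrals of cos theta there. Dividing by the height of the
   strip, with either sign, gives (cos theta)' = H sin theta along the curve.
   Exchanging the coordinates (and reversing the curve) gives
   (sin theta)' = - H cos theta, and together these say theta' = - H. *)
Require Import Defs.
From mathcomp Require Import all_boot all_order all_algebra.
From mathcomp Require Import all_classical all_reals all_analysis.
From mathcomp Require Import ring lra.
Import Order.TTheory GRing.Theory Num.Theory.
Import numFieldNormedType.Exports.
Local Open Scope classical_set_scope.
Local Open Scope ring_scope.

(** * Integrals of continuous functions *)

(** The difficulty is that the angle is merely continuous, so the variation of N across the curve
    cannot be estimated. Comparing an arc with its translate by t leaves the defect 1 - N . N_t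
    under the integral along the arc; continuity gives it no rate in t, so it cannot be discarded
    after division by t. It is however nonnegative whatever the sign of t, and only this is used: t
    > 0 and t < 0 give opposite bounds on the same increment. Treating both components of N also
    avoids asking where the curve is a graph over an axis: both derivative formulas hold at every
    point, and the angle is recovered from them without dividing by its sine or cosine. The argument
    is local. Near a point of the curve the data are extended from a rectangle to the whole plane by
    a retraction, so that the integral calculus can be done with functions continuous everywhere. *)

Definition integ {R : realType} (a b : R) (f : R -> R) : R :=
  \int[lebesgue_measure]_(t in `[a, b]) f t.

Lemma continuous_for_pair {T U V W : topologicalType} (f : T -> U) (g : T -> V)
    (F : U * V -> W) (x : T) :
  {for x, continuous f} -> {for x, continuous g} ->
  {for (f x, g x), continuous F} -> {for x, continuous (fun t => F (f t, g t))}.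
Proof.
move=> cf cg cF; apply: (@continuous_comp _ _ _ (fun t => (f t, g t)) F) => //.
exact: (cvg_pair cf cg).
Qed.

Section Integral1D.
Context {R : realType}.
Implicit Types (f g F : R -> R) (a b c x : R).

Lemma continuous_integrable_itv f a b : continuous f ->
  lebesgue_measure.-integrable `[a, b] (EFin \o f).
Proof.
move=> cf; apply: continuous_compact_integrable; first exact: segment_compact.
exact: continuous_subspaceT.
Qed.

Lemma eq_integ f g a b : (forall x, a <= x <= b -> f x = g x) ->
  integ a b f = integ a b g.
Proof.
by move=> fg; apply: eq_Rintegral => x; rewrite inE/= in_itv/= => /fg.
Qed.

Lemma integD f g a b : continuous f -> continuous g ->
  integ a b (fun t => f t + g t) = integ a b f + integ a b g.
Proof.
by move=> cf cg; apply: RintegralD => //; exact: continuous_integrable_itv.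
Qed.

Lemma integB f g a b : continuous f -> continuous g ->
  integ a b (fun t => f t - g t) = integ a b f - integ a b g.
Proof.
by move=> cf cg; apply: RintegralB => //; exact: continuous_integrable_itv.
Qed.

Lemma integZr f k a b : continuous f ->
  integ a b (fun t => f t * k) = integ a b f * k.
Proof. by move=> cf; apply: RintegralZr => //; exact: continuous_integrable_itv. Qed.

(** The base point lies strictly to the left because [integ a z f] is 0, not a negated integral, for
    [z < a], and so need not be differentiable at [a]. This is why later primitives start a little
    before the interval of interest. *)
Lemma integ_FTC1 f a x : continuous f -> a < x ->
  is_derive x 1 (fun z => integ a z f) (f x).
Proof.
move=> cf ax; have xx : x < x + 1 by rewrite ltrDl.
have [d1 d2] := continuous_FTC1_closed xx
  (@continuous_integrable_itv f a (x + 1) cf) ax (cf x).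
apply: DeriveDef; first exact: d1.
by rewrite -derive1E; exact: d2.
Qed.

Lemma is_derive_continuous f x (d : R) : is_derive x 1 f d ->
  {for x, continuous f}.
Proof. by case=> /derivable1_diffP/differentiable_continuous. Qed.

Lemma integ_FTC2 f F a b : a < b -> continuous f ->
  (forall x, a <= x <= b -> is_derive x 1 F (f x)) -> integ a b f = F b - F a.
Proof.
move=> ab cf dF.
have cF x : a <= x <= b -> {for x, continuous F}.
  by move=> /dF; exact: is_derive_continuous.
rewrite /integ /Rintegral (@continuous_FTC2 R f F)//.
- exact: continuous_subspaceT.
- split => [x||].
  + by rewrite in_itv/= => /andP[ax xb]; case: (dF x _) => //; rewrite !ltW.
  + by apply/cvg_at_right_filter/cF; rewrite lexx ltW.
  + by apply/cvg_at_left_filter/cF; rewrite lexx ltW.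
- move=> x; rewrite in_itv/= => /andP[ax xb].
  by rewrite derive1E; case: (dF x _) => //; rewrite !ltW.
Qed.

Lemma integ_split f a b c : continuous f -> a <= b -> b <= c ->
  integ a c f = integ a b f + integ b c f.
Proof.
move=> cf ab bc; apply/eqP; rewrite addrC -subr_eq; apply/eqP.
rewrite /integ Rintegral_itvB ?bnd_simp//; last exact: continuous_integrable_itv.
rewrite Rintegral_itv_obnd_cbnd//.
apply: integrableS (@continuous_integrable_itv f b c cf) => //.
by apply: subset_itvr; rewrite bnd_simp.
Qed.

Lemma integ_ge0 f a b : (forall x, a <= x <= b -> 0 <= f x) -> 0 <= integ a b f.
Proof. by move=> f0; apply: Rintegral_ge0 => x; rewrite /= in_itv/= => /f0. Qed.

Lemma integ_point f a : integ a a f = 0.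
Proof. by rewrite /integ set_itv1 Rintegral_set1. Qed.

(** If the integral were 0, nonnegativity would make the primitive vanish on all of [[a, b]], and
    hence its derivative [f x] as well. *)
Lemma integ_gt0 f a b x : continuous f -> (forall x, a <= x <= b -> 0 <= f x) ->
  a < x < b -> 0 < f x -> 0 < integ a b f.
Proof.
move=> cf f0 /andP[ax xb] fx0.
have dF z : a < z -> is_derive z 1 (fun z => integ a z f) (f z).
  by exact: integ_FTC1.
rewrite lt_neqAle integ_ge0// andbT; apply/negP => /eqP I0.
have Ile z : a <= z <= b -> integ a z f = 0.
  move=> /andP[az zb]; apply/eqP; rewrite eq_le; apply/andP; split; last first.
    by apply: integ_ge0 => y /andP[ay yz]; rewrite f0// ay (le_trans yz).
  rewrite I0 (integ_split f a z b)// lerDl integ_ge0// => y /andP[zy yb].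
  by rewrite f0// yb (le_trans az).
have : is_derive x 1 (fun z => integ a z f) 0.
  have := is_derive_cst (0 : R) x 1; apply: near_eq_is_derive.
  have : \forall z \near x, z \in `]a, b[ by apply: near_in_itvoo; rewrite in_itv/= ax.
  apply: filterS => z; rewrite in_itv/= => /andP[az zb].
  by apply/esym/Ile; rewrite !ltW.
case=> _ d0; case: (dF x ax) => _; rewrite d0 => /esym fx.
by rewrite fx ltxx in fx0.
Qed.

End Integral1D.

(** * Measurability and Fubini on rectangles *)

Section Integral2D.
Context {R : realType}.
Implicit Types (G : R * R -> R) (a b c d : R).
Let mR := measurableTypeR R.

(** The sigma-algebra is generated by rectangles and the topology by balls of the sup norm; an open
    set is the countable union of the rational boxes that it contains. *)
Lemma open_measurable2 (U : set (R * R)) : open U ->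
  measurable (U : set (mR * mR)).
Proof.
move=> oU.
pose box (q : rat * rat * (rat * rat)) : set (R * R) :=
  `]ratr q.1.1, ratr q.1.2[ `*` `]ratr q.2.1, ratr q.2.2[.
pose W q := if asbool (box q `<=` U) then box q else set0.
suff -> : U = \bigcup_q W q.
  apply: countable_bigcupT_measurable; first exact: countableP.
  move=> q; rewrite /W; case: ifP => _; last exact: measurable0.
  by apply: measurableX; exact: measurable_itv.
apply/seteqP; split => [p Up|p [q _]]; last first.
  by rewrite /W; case: asboolP => // qU /qU.
have /nbhs_ballP[e /= e0 eU] : nbhs p U by exact: open_nbhs_nbhs.
have pick (t : R) : exists q : rat * rat, t - e < ratr q.1 < t /\ t < ratr q.2 < t + e.
  have [|q1] := @rat_in_itvoo R (t - e) t; first by rewrite ltrBlDr ltrDl.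
  rewrite in_itv/= => h1.
  have [|q2] := @rat_in_itvoo R t (t + e); first by rewrite ltrDl.
  by rewrite in_itv/= => h2; exists (q1, q2).
have [q1 [/andP[a1 a2] /andP[a3 a4]]] := pick p.1.
have [q2 [/andP[b1 b2] /andP[b3 b4]]] := pick p.2.
exists (q1, q2) => //; rewrite /W; case: asboolP => [_|[]].
  by split => /=; rewrite in_itv/= ?a2 ?b2.
move=> [z1 z2] [] /=; rewrite !in_itv/= => /andP[c1 c2] /andP[d1 d2].
apply: eU; split; rewrite /ball/= ltr_distl; lra.
Qed.

Lemma continuous_measurable2 G : continuous G ->
  measurable_fun setT (G : mR * mR -> R).
Proof.
move=> cG; apply: (measurability _ (measurable_realfun.RGenOpens.measurableE R)).
move=> _ [_ [a [b ->] <-]]; rewrite setTI; apply: open_measurable2.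
by apply: open_comp => [x _|]; [exact: cG|exact: interval_open].
Qed.

Lemma rect_integrable G a b c d : continuous G ->
  (lebesgue_measure \x lebesgue_measure)%E.-integrable (`[a, b] `*` `[c, d])
    (EFin \o G).
Proof.
move=> cG; apply: measurable_bounded_integrable.
- by apply: measurableX; exact: measurable_itv.
- have E := @product_measure1E _ _ mR mR R lebesgue_measure lebesgue_measure
    `[a, b]%classic `[c, d]%classic (measurable_itv _) (measurable_itv _).
  apply: (@le_lt_trans _ _ (lebesgue_measure (`[a, b]%classic : set mR) *
    lebesgue_measure (`[c, d]%classic : set mR))%E).
    by rewrite -E.
  by rewrite !lebesgue_measure_itv/=; case: ifP => _; case: ifP => _;
    rewrite ?mule0 ?mul0e// -!EFinD -EFinM ltry.
- by apply: measurable_funTS; exact: continuous_measurable2.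
- have : compact (`[a, b]%classic `*` `[c, d]%classic : set (R * R)).
    by apply: compact_setX; exact: segment_compact.
  have cGr : {within `[a, b]%classic `*` `[c, d]%classic, continuous G}.
    exact: continuous_subspaceT.
  move=> /(continuous_compact cGr)/compact_bounded[M [_ mrt]].
  by exists M; split; rewrite ?num_real // => ? ? ? ?; exact: mrt.
Qed.

Lemma continuous_slice1 G y : continuous G -> continuous (fun x => G (x, y)).
Proof.
move=> cG x; apply: continuous_for_pair; [exact: cvg_id|exact: cvg_cst|exact: cG].
Qed.

Lemma continuous_slice2 G x : continuous G -> continuous (fun y => G (x, y)).
Proof.
move=> cG y; apply: continuous_for_pair; [exact: cvg_cst|exact: cvg_id|exact: cG].
Qed.

Lemma continuous_swap G : continuous G -> continuous (fun p => G (p.2, p.1)).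
Proof.
move=> cG p; apply: continuous_for_pair; [exact: cvg_snd|exact: cvg_fst|exact: cG].
Qed.

(** Continuity under the integral sign, dominated by a constant that comes from compactness of the
    rectangle of half-width 1 around [x0]. *)
Lemma integ_param_continuous1 G c d : continuous G ->
  continuous (fun x => integ c d (fun y => G (x, y))).
Proof.
move=> cG x0.
have [M GM] : exists M, forall x y, x0 - 1 <= x <= x0 + 1 -> c <= y <= d ->
    `|G (x, y)| <= M.
  have : compact (`[x0 - 1, x0 + 1]%classic `*` `[c, d]%classic : set (R * R)).
    by apply: compact_setX; exact: segment_compact.
  have cGr : {within `[x0 - 1, x0 + 1]%classic `*` `[c, d]%classic, continuous G}.
    exact: continuous_subspaceT.
  move=> /(continuous_compact cGr)/compact_bounded[M [_ /(_ (M + 1))]].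
  rewrite ltrDl => /(_ ltr01) GM; exists (M + 1) => x y hx hy.
  by apply: GM; exists (x, y) => //; split; rewrite /= in_itv.
have mcd : measurable (`[c, d]%classic : set mR) by exact: measurable_itv.
apply: (@continuity_under_integral R _ mR lebesgue_measure (fun x y => G (x, y))
  `[c, d] mcd (x0 - 1) (x0 + 1) _ _ (cst M)).
- by move=> x _; apply: continuous_integrable_itv; exact: continuous_slice2.
- by apply: aeW => y _ x _; exact: continuous_slice1.
- by apply: continuous_integrable_itv; exact: cst_continuous.
- move=> x; rewrite /= in_itv/= => /andP[h1 h2]; apply: aeW => y.
  by rewrite /= in_itv/= => hy; apply: GM => //; rewrite !ltW.
- by rewrite inE/= in_itv/=; apply/andP; split; rewrite ?ltrDl// ltrBlDr ltrDl.
Qed.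

Lemma integ_EFin (f : R -> R) a b : continuous f ->
  (\int[lebesgue_measure]_(t in `[a, b]) (f t)%:E)%E = (integ a b f)%:E.
Proof.
move=> cf; rewrite /integ /Rintegral fineK//; apply: integrable_fin_num => //.
exact: continuous_integrable_itv.
Qed.

(** Fubini is applied to [G] cut off by zero outside the rectangle; a slice of the cut-off function
    is either a cut-off slice of [G] or identically zero. *)
Lemma integral_rectE G a b c d : continuous G ->
  (\int[lebesgue_measure \x lebesgue_measure]_(p in `[a, b] `*` `[c, d]) (G p)%:E
   = (integ a b (fun x => integ c d (fun y => G (x, y))))%:E)%E.
Proof.
move=> cG; set D : set (mR * mR) := `[a, b] `*` `[c, d].
have mD : measurable D by apply: measurableX; exact: measurable_itv.
have iG := @rect_integrable G a b c d cG.
have iGD := (@integrable_mkcond _ _ R (lebesgue_measure \x lebesgue_measure)%E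
  D (EFin \o G) mD).1 iG.
rewrite integral_mkcond -(integral12_prod_meas1 iGD).
rewrite -integ_EFin; last exact: integ_param_continuous1.
rewrite [RHS]integral_mkcond; apply: eq_integral => x _.
rewrite /fubini_F patchE; case: ifPn => xab.
  rewrite -integ_EFin; last exact: continuous_slice2.
  rewrite [RHS]integral_mkcond; apply: eq_integral => y _.
  by rewrite !patchE /D in_setX xab.
by apply: integral0_eq => y _; rewrite patchE /D in_setX (negbTE xab).
Qed.

Lemma integral_rectE_swap G a b c d : continuous G ->
  (\int[lebesgue_measure \x lebesgue_measure]_(p in `[a, b] `*` `[c, d]) (G p)%:E
   = (integ c d (fun y => integ a b (fun x => G (x, y))))%:E)%E.
Proof.
move=> cG; set D : set (mR * mR) := `[a, b] `*` `[c, d].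
have mD : measurable D by apply: measurableX; exact: measurable_itv.
have iG := @rect_integrable G a b c d cG.
have cG' := @continuous_swap G cG.
have iGD := (@integrable_mkcond _ _ R (lebesgue_measure \x lebesgue_measure)%E
  D (EFin \o G) mD).1 iG.
rewrite integral_mkcond -(integral21_prod_meas1 iGD).
rewrite -integ_EFin; last exact: (integ_param_continuous1 _ _ _ cG').
rewrite [RHS]integral_mkcond; apply: eq_integral => y _.
rewrite /fubini_G patchE; case: ifPn => ycd.
  rewrite -integ_EFin; last exact: continuous_slice1.
  rewrite [RHS]integral_mkcond; apply: eq_integral => x _.
  by rewrite !patchE /D in_setX ycd andbT.
by apply: integral0_eq => x _; rewrite patchE /D in_setX (negbTE ycd) andbF.
Qed.

Lemma integ_swap G a b c d : continuous G ->
  integ a b (fun x => integ c d (fun y => G (x, y))) =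
  integ c d (fun y => integ a b (fun x => G (x, y))).
Proof.
by move=> cG; apply: EFin_inj; rewrite -integral_rectE// integral_rectE_swap.
Qed.

End Integral2D.

(** * Smooth plateau functions *)

(** The derivative is an existential witness, so that closure under the algebraic operations follows
    by induction without computing iterated derivatives. *)
Fixpoint nderivable {R : realType} (k : nat) (f : R -> R) : Prop :=
  if k is k'.+1 then
    exists2 g : R -> R, forall x : R, is_derive x 1 f (g x) & nderivable k' g
  else True.

Definition smooth {R : realType} (f : R -> R) := forall k, nderivable k f.

Section Derive.
Context {R : realType}.
Implicit Types (f g : R -> R) (x : R).

Lemma is_derive_eps f x (l : R) :
  (forall e, 0 < e -> exists2 d, 0 < d &
    forall h, `|h| < d -> `|f (x + h) - f x - l * h| <= e * `|h|) ->
  is_derive x 1 f l.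
Proof.
move=> H; have cv : h^-1 *: ((f \o shift x) (h *: 1) - f x) @[h --> 0^'] --> l.
  apply/cvgrPdist_le => e e0; have [d d0 hd] := H e e0.
  have h0 : \forall h \near 0^', h != 0 :> R by exact: nbhs_dnbhs_neq.
  have hlt : \forall h \near (0 : R)^', `|h| < d.
    apply: nbhs_dnbhs; apply/nbhs_ballP; exists d => // h.
    by rewrite /ball/= sub0r normrN.
  apply: filterS2 h0 hlt => h h0 hlt.
  have -> : l - h^-1 *: ((f \o shift x) (h *: 1) - f x) =
      - (h^-1 * (f (x + h) - f x - l * h)).
    by rewrite /GRing.scale/= mulr1 [h + x]addrC; field.
  rewrite normrN normrM normfV ler_pdivrMl ?normr_gt0// [X in _ <= X]mulrC.
  exact: hd.
by apply: DeriveDef; [apply/cvg_ex; exists l | exact: cvg_lim cv].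
Qed.

End Derive.

Section Smooth.
Context {R : realType}.
Implicit Types (f g : R -> R) (k : nat) (x : R).

Lemma is_derive_uniq f x (a b : R) :
  is_derive x 1 f a -> is_derive x 1 f b -> a = b.
Proof. by case=> _ <- [_ <-]. Qed.

Lemma nderivableW k f : nderivable k.+1 f -> nderivable k f.
Proof. by elim: k f => // k IH f [g df Dg]; exists g => //; exact: IH. Qed.

Lemma nderivable_cst k (c : R) : nderivable k (fun=> c).
Proof.
elim: k c => //= k IH c; exists (fun=> 0) => // x; exact: is_derive_cst.
Qed.

Lemma nderivableD k f g : nderivable k f -> nderivable k g ->
  nderivable k (fun x => f x + g x).
Proof.
elim: k f g => //= k IH f g [f' df Df] [g' dg Dg].
exists (fun x => f' x + g' x); last exact: IH.
by move=> x; exact: is_deriveD.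
Qed.

Lemma nderivableN k f : nderivable k f -> nderivable k (fun x => - f x).
Proof.
elim: k f => //= k IH f [f' df Df]; exists (fun x => - f' x); last exact: IH.
by move=> x; exact: is_deriveN.
Qed.

Lemma nderivableM k f g : nderivable k f -> nderivable k g ->
  nderivable k (fun x => f x * g x).
Proof.
elim: k f g => // k IH f g Df Dg.
have := nderivableW _ _ Df; have := nderivableW _ _ Dg;
  case: Df Dg => [f' df Df] [g' dg Dg] ? ?.
exists (fun x => f' x * g x + f x * g' x); last by apply: nderivableD; exact: IH.
move=> x; apply: is_derive_eq (is_deriveM (df x) (dg x)) _.
by rewrite /GRing.scale/=; ring.
Qed.

Lemma nderivableV k f : (forall x, f x != 0) -> nderivable k f ->
  nderivable k (fun x => (f x)^-1).
Proof.
move=> f0; elim: k => // k IH Df; have DVf := IH (nderivableW _ _ Df).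
case: Df => [f' df Df]; exists (fun x => - (f' x * ((f x)^-1 * (f x)^-1))).
  move=> x; apply: is_derive_eq (is_deriveV (f0 x) (df x)) _.
  by rewrite /GRing.scale/= mulNr expr2 invfM mulrC.
by apply: nderivableN; apply: nderivableM => //; exact: nderivableM.
Qed.

Lemma nderivable_affine k f (p q : R) : nderivable k f ->
  nderivable k (fun x => f (p * x + q)).
Proof.
elim: k f => //= k IH f [f' df Df]; exists (fun x => f' (p * x + q) * p).
  move=> x; have h : is_derive x 1 (fun x => p * x + q) p.
    have h1 := is_deriveZ p (is_derive_id x (1 : R)).
    have := is_deriveD h1 (is_derive_cst q x 1).
    by rewrite addr0 [_%:A]mulr1; exact.
  exact: (is_derive1_comp (df _) h).
by apply: nderivableM; [exact: IH|exact: nderivable_cst].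
Qed.

(** Each order provides its own derivative; uniqueness identifies them, so a single [g] serves all
    orders. *)
Lemma smooth_derive f : smooth f ->
  exists2 g : R -> R, forall x, is_derive x 1 f (g x) & smooth g.
Proof.
move=> sf; have [g dg _] := sf 1%N; exists g => // k.
have [h dh Dh] := sf k.+1; suff -> : g = h by [].
by apply/funext => x; exact: is_derive_uniq (dg x) (dh x).
Qed.

Lemma smooth_continuous f : smooth f -> continuous f.
Proof. by move=> /smooth_derive[g dg _] x; exact: is_derive_continuous (dg x). Qed.

(* The span of the family is closed under differentiation, so smoothness at 0
   follows without the usual polynomials in [1/x]. *)
Definition flat (k : nat) (x : R) : R :=
  if 0 < x then x^-1 ^+ k * expR (- x^-1) else 0.

Lemma flat_le0 k x : x <= 0 -> flat k x = 0.
Proof. by rewrite /flat leNgt; case: ifP. Qed.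

Lemma flat_ge0 k x : 0 <= flat k x.
Proof.
rewrite /flat; case: ifP => // x0; rewrite mulr_ge0 ?expR_ge0// exprn_ge0//.
by rewrite invr_ge0 ltW.
Qed.

Lemma flat_gt0 k x : 0 < x -> 0 < flat k x.
Proof. by move=> x0; rewrite /flat x0 mulr_gt0 ?expR_gt0// exprn_gt0// invr_gt0. Qed.

(** The inequality [1 + u <= expR u] at [u = t / n], raised to the power [n]. *)
Lemma expr_le_expR n (t : R) : 0 <= t -> t ^+ n <= n%:R ^+ n * expR t.
Proof.
case: n => [|n] t0; first by rewrite !expr0 mul1r -expR0 ler_expR.
have n0 : (0 : R) < n.+1%:R by rewrite ltr0n.
have -> : expR t = expR (t / n.+1%:R) ^+ n.+1.
  by rewrite -expRM_natl mulrCA divff ?mulr1// gt_eqF.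
have h : t <= n.+1%:R * expR (t / n.+1%:R).
  rewrite -ler_pdivrMl// mulrC; apply: le_trans (expR_ge1Dx _).
  by rewrite lerDr.
by rewrite -exprMn lerXn2r// nnegrE mulr_ge0 ?ler0n ?expR_ge0.
Qed.

(** The exponential bound is used at order [k + 1], one more than needed for boundedness, which
    leaves a factor [x]. *)
Lemma flat_le k x : 0 < x -> flat k x <= k.+1%:R ^+ k.+1 * x.
Proof.
move=> x0; rewrite /flat x0.
have xi : 0 <= x^-1 by rewrite invr_ge0 ltW.
have := expr_le_expR k.+1 _ xi.
rewrite -ler_pdivrMr ?expR_gt0// exprS expRN => h.
by rewrite -ler_pdivrMr// (le_trans _ h)// le_eqVlt mulrC mulrA eqxx.
Qed.

Lemma is_derive_exprV k x : 0 < x ->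
  is_derive x 1 (fun z : R => z^-1 ^+ k) (- (k%:R * x^-1 ^+ k.+1)).
Proof.
move=> x0; have dv : is_derive x 1 (fun z : R => z^-1) (- (x^-1 ^+ 2)).
  apply: is_derive_eq (is_deriveV _ (is_derive_id x (1 : R))) _.
    by rewrite gt_eqF.
  by rewrite /GRing.scale/= mulr1 exprVn.
elim: k => [|k IH].
  by rewrite mul0r oppr0; exact: is_derive_cst.
have -> : (fun z : R => z^-1 ^+ k.+1) = (fun z => z^-1 * z^-1 ^+ k).
  by apply/funext => z; rewrite exprS.
apply: is_derive_eq (is_deriveM dv IH) _.
by rewrite /GRing.scale/= -natr1 !exprS; ring.
Qed.

Lemma is_derive_flat k x :
  is_derive x 1 (flat k) (flat k.+2 x - k%:R * flat k.+1 x).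
Proof.
case: (ltgtP x 0) => x0.
- rewrite !flat_le0 ?ltW// mulr0 subr0.
  have := is_derive_cst (0 : R) x 1; apply: near_eq_is_derive.
  have : \forall z \near x, z < 0 by exact: lt_nbhsl.
  by apply: filterS => z z0; rewrite flat_le0// ltW.
- have dX := is_derive_exprV k _ x0.
  have dV := is_derive_exprV 1 _ x0.
  have dE := is_derive1_comp (is_derive_expR _) (is_deriveN dV).
  have : is_derive x 1 (fun z => z^-1 ^+ k * expR (- z^-1))
      (flat k.+2 x - k%:R * flat k.+1 x).
    apply: is_derive_eq (is_deriveM dX dE) _.
    rewrite /flat x0 /GRing.scale/=.
    have -> : (- (fun z : R => z^-1 ^+ 1)) x = - x^-1 by [].
    by rewrite !exprS; ring.
  apply: near_eq_is_derive.
  have : \forall z \near x, 0 < z by exact: lt_nbhsr.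
  by apply: filterS => z z0; rewrite /flat z0.
- rewrite x0 !flat_le0// mulr0 subr0; apply: is_derive_eps => e e0.
  (* For [h > 0], [flat k h = h * flat k.+1 h <= C * h ^ 2], so the derivative at 0 is 0. *)
  set C : R := k.+2%:R ^+ k.+2.
  have C0 : 0 < C by rewrite exprn_gt0// ltr0n.
  exists (e / C) => [|h]; first by rewrite divr_gt0.
  rewrite ltr_pdivlMr// => hC; rewrite add0r (flat_le0 _ _ (lexx 0)) mul0r !subr0.
  case: (leP h 0) => h0; first by rewrite flat_le0// normr0 mulr_ge0// ltW.
  have -> : flat k h = h * flat k.+1 h.
    by rewrite /flat h0 exprS !mulrA divff ?mul1r// gt_eqF.
  rewrite (gtr0_norm h0) in hC *.
  have hf : 0 <= h * flat k.+1 h by rewrite mulr_ge0 ?flat_ge0// ltW.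
  rewrite (ger0_norm hf) [e * h]mulrC ler_pM2l//.
  by apply: le_trans (flat_le _ _ h0) _; rewrite mulrC ltW.
Qed.

Lemma smooth_flat k : smooth (flat k).
Proof.
move=> n; elim: n k => //= n IH k;
  exists (fun x => flat k.+2 x - k%:R * flat k.+1 x).
  exact: is_derive_flat.
by apply: nderivableD => //; apply: nderivableN; apply: nderivableM => //;
  exact: nderivable_cst.
Qed.

Definition step (t : R) : R := flat 0 t * (flat 0 t + flat 0 (1 - t))^-1.

(** The derivative of [step]. Since [flat 0] has derivative [flat 2], the quotient rule takes this
    form, in which the sign and the vanishing outside the unit interval are visible. *)
Definition dstep (t : R) : R :=
  (flat 2 t * flat 0 (1 - t) + flat 0 t * flat 2 (1 - t)) *
  ((flat 0 t + flat 0 (1 - t))^-1 ^+ 2).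

Lemma step_den_gt0 t : 0 < flat 0 t + flat 0 (1 - t).
Proof.
have [t0|t0] := leP t 0.
  by rewrite ltr_wpDl ?flat_ge0// flat_gt0//; lra.
by rewrite ltr_wpDr ?flat_ge0// flat_gt0.
Qed.

Lemma smooth_step : smooth step.
Proof.
have aff k : smooth (fun t => flat k (1 - t)).
  move=> n; have -> : (fun t => flat k (1 - t)) = (fun t => flat k (-1 * t + 1)).
    by apply/funext => t; congr flat; ring.
  by apply: nderivable_affine; exact: smooth_flat.
move=> n; apply: nderivableM; first exact: smooth_flat.
apply: nderivableV; first by move=> x; rewrite gt_eqF// step_den_gt0.
by apply: nderivableD; [exact: smooth_flat|exact: aff].
Qed.

Lemma is_derive_step (t : R) : is_derive t 1 step (dstep t).
Proof.
have d1 := is_derive_flat 0 t; rewrite mul0r subr0 in d1.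
have d2 := is_derive_flat 0 (1 - t); rewrite mul0r subr0 in d2.
have d3 : is_derive t 1 (fun t : R => 1 - t) (-1).
  by have := is_deriveB (is_derive_cst (1 : R) t 1) (is_derive_id t (1 : R));
    rewrite sub0r.
have d4 : is_derive t 1 (fun t : R => flat 0 (1 - t)) (flat 2 (1 - t) * -1).
  exact: (@is_derive1_comp R (flat 0) (fun t => 1 - t) t _ _ d2 d3).
have n0 : flat 0 t + flat 0 (1 - t) != 0 by rewrite gt_eqF// step_den_gt0.
have d5 : is_derive t 1 (fun t : R => flat 0 t + flat 0 (1 - t))
    (flat 2 t + flat 2 (1 - t) * -1) by exact: is_deriveD d1 d4.
have d6 := @is_deriveV R (fun t => flat 0 t + flat 0 (1 - t)) t _ _ n0 d5.
apply: is_derive_eq (is_deriveM d1 d6) _.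
by rewrite /dstep /GRing.scale/=; field.
Qed.

Lemma dstep_ge0 t : 0 <= dstep t.
Proof.
rewrite /dstep mulr_ge0 ?exprn_ge0 ?invr_ge0 ?(ltW (step_den_gt0 _))//.
by rewrite addr_ge0// mulr_ge0 ?flat_ge0.
Qed.

Lemma dstep_out t : t <= 0 \/ 1 <= t -> dstep t = 0.
Proof.
rewrite /dstep; case=> h.
  by rewrite !(flat_le0 _ _ h) !mul0r addr0 mul0r.
have h' : 1 - t <= 0 by lra.
by rewrite !(flat_le0 _ _ h') !mulr0 addr0 mul0r.
Qed.

Lemma step_le0 t : t <= 0 -> step t = 0.
Proof. by move=> t0; rewrite /step flat_le0// mul0r. Qed.

Lemma step_ge1 t : 1 <= t -> step t = 1.
Proof.
move=> t1; have h' : 1 - t <= 0 by lra.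
by rewrite /step (flat_le0 _ _ h') addr0 divff// gt_eqF// flat_gt0//; lra.
Qed.

Lemma step_ge0 t : 0 <= step t.
Proof.
by rewrite /step mulr_ge0 ?flat_ge0// invr_ge0 ltW// step_den_gt0.
Qed.

Lemma dstep_pos : exists2 c : R, 0 < c < 1 & 0 < dstep c.
Proof.
have [c cab E] := @MVT R step dstep 0 1 ltr01 (fun x _ => is_derive_step x)
  (continuous_subspaceT (smooth_continuous _ smooth_step)).
exists c; first by move: cab; rewrite in_itv.
by move: E; rewrite step_ge1// step_le0// !subr0 mulr1 => <-.
Qed.

(** The product of a step rising on [[x0, x0 + d]] and one falling on [[x1 - d, x1]]. Up to scale,
    [a'] imitates a point mass at [x0] minus one at [x1]; the two sign conditions overlap in the
    middle and force [a' = 0] there. *)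
Lemma plateau x0 x1 d : 0 < d -> x0 + d < x1 - d ->
  exists a a' : R -> R,
  [/\ smooth a, forall x, is_derive x 1 a (a' x),
      forall x, x <= x0 \/ x1 <= x -> a x = 0 /\ a' x = 0,
      (forall x, x < x1 - d -> 0 <= a' x) /\ (forall x, x0 + d < x -> a' x <= 0) &
      exists2 c, x0 < c < x0 + d & 0 < a' c].
Proof.
move=> d0 xx.
pose u x := d^-1 * x + - (d^-1 * x0); pose v x := - d^-1 * x + d^-1 * x1.
have uE x : u x = (x - x0) / d by rewrite /u; field; exact: lt0r_neq0.
have vE x : v x = (x1 - x) / d by rewrite /v; field; exact: lt0r_neq0.
have du x : is_derive x 1 (fun x => step (u x)) (dstep (u x) * d^-1).
  have h : is_derive x 1 u d^-1.
    have h1 := is_deriveZ d^-1 (is_derive_id x (1 : R)).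
    have := is_deriveD h1 (is_derive_cst (- (d^-1 * x0)) x 1).
    by rewrite addr0 [_%:A]mulr1; exact.
  exact: (is_derive1_comp (is_derive_step _) h).
have dv x : is_derive x 1 (fun x => step (v x)) (dstep (v x) * - d^-1).
  have h : is_derive x 1 v (- d^-1).
    have h1 := is_deriveZ (- d^-1) (is_derive_id x (1 : R)).
    have := is_deriveD h1 (is_derive_cst (d^-1 * x1) x 1).
    by rewrite addr0 [_%:A]mulr1; exact.
  exact: (is_derive1_comp (is_derive_step _) h).
have di0 : 0 < d^-1 by rewrite invr_gt0.
pose a' x := d^-1 * (dstep (u x) * step (v x) - step (u x) * dstep (v x)).
have v1 x : x <= x1 - d -> 1 <= v x.
  by move=> h; rewrite vE ler_pdivlMr// mul1r; lra.
have u1 x : x0 + d <= x -> 1 <= u x.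
  by move=> h; rewrite uE ler_pdivlMr// mul1r; lra.
have u0 x : x <= x0 -> u x <= 0.
  by move=> h; rewrite uE ler_pdivrMr// mul0r; lra.
have v0 x : x1 <= x -> v x <= 0.
  by move=> h; rewrite vE ler_pdivrMr// mul0r; lra.
exists (fun x => step (u x) * step (v x)), a'; split.
- by move=> n; apply: nderivableM; apply: nderivable_affine; exact: smooth_step.
- move=> x; apply: is_derive_eq (is_deriveM (du x) (dv x)) _.
  by rewrite /a' /GRing.scale/=; ring.
- move=> x [h|h]; rewrite /a'.
    by rewrite (step_le0 _ (u0 _ h)) (dstep_out _ (or_introl (u0 _ h))) !mul0r subrr mulr0.
  by rewrite (step_le0 _ (v0 _ h)) (dstep_out _ (or_introl (v0 _ h))) !mulr0 subrr mulr0.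
- split=> x h; rewrite /a'.
    rewrite (dstep_out _ (or_intror (v1 _ (ltW h)))) mulr0 subr0.
    by apply: mulr_ge0; [rewrite ltW|rewrite mulr_ge0 ?dstep_ge0 ?step_ge0].
  rewrite (dstep_out _ (or_intror (u1 _ (ltW h)))) mul0r sub0r mulrN oppr_le0.
  by apply: mulr_ge0; [rewrite ltW|rewrite mulr_ge0 ?dstep_ge0 ?step_ge0].
- have [c /andP[c0 c1] cpos] := dstep_pos.
  have cd : 0 < c * d by rewrite mulr_gt0.
  have cd1 : c * d < d by rewrite -[ltRHS]mul1r ltr_pM2r.
  exists (x0 + c * d); first lra.
  rewrite /a' (dstep_out (v _)); last by right; apply: v1; lra.
  rewrite (step_ge1 (v _)); last by apply: v1; lra.
  have -> : u (x0 + c * d) = c by rewrite uE; field; exact: lt0r_neq0.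
  by rewrite mulr0 subr0 mulr1 mulr_gt0.
Qed.

End Smooth.

(** * Weak derivatives in one variable *)

(** The margins [lo < p] and [q < hi] keep the closed support inside the open interval. *)
Definition bump {R : realType} (lo hi : R) (a a' : R -> R) :=
  [/\ smooth a, forall x : R, is_derive x 1 a (a' x) &
   exists p q, [/\ lo < p, q < hi & forall x, x <= p \/ q <= x -> a x = 0 /\ a' x = 0]].

Section ContinuousAlgebra.
Context {R : realType} {T : topologicalType}.
Implicit Types f g : T -> R.

Lemma continuous_funM f g : continuous f -> continuous g ->
  continuous (fun x => f x * g x).
Proof. by move=> cf cg x; apply: cvgM; [exact: cf|exact: cg]. Qed.

Lemma continuous_funD f g : continuous f -> continuous g ->
  continuous (fun x => f x + g x).
Proof. by move=> cf cg x; apply: cvgD; [exact: cf|exact: cg]. Qed.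

Lemma continuous_funB f g : continuous f -> continuous g ->
  continuous (fun x => f x - g x).
Proof. by move=> cf cg x; apply: cvgB; [exact: cf|exact: cg]. Qed.

End ContinuousAlgebra.

Section Weak1D.
Context {R : realType}.
Implicit Types (A B P a : R -> R).

Lemma bump_continuous lo hi a a' : bump lo hi a a' ->
  continuous a /\ continuous (a' : R -> R).
Proof.
move=> [sa da _]; split; first exact: smooth_continuous.
have [g dg sg] := smooth_derive _ sa; suff -> : a' = g by exact: smooth_continuous.
by apply/funext => x; exact: is_derive_uniq (da x) (dg x).
Qed.

Lemma continuous_maxl (c : R) : continuous (fun x : R => Num.max c x).
Proof.
have -> : (fun x : R => Num.max c x) = (fun x => (c + x + `|c - x|) / 2).
  by apply/funext => x; rewrite maxr_absE.
move=> x; apply: cvgM; last exact: cvg_cst.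
apply: cvgD; first by apply: cvgD; [exact: cvg_cst|exact: cvg_id].
by apply: cvg_norm; apply: cvgB; [exact: cvg_cst|exact: cvg_id].
Qed.

Lemma continuous_minl (c : R) : continuous (fun x : R => Num.min c x).
Proof.
have -> : (fun x : R => Num.min c x) = (fun x => (c + x - `|c - x|) / 2).
  by apply/funext => x; rewrite minr_absE.
move=> x; apply: cvgM; last exact: cvg_cst.
apply: cvgB; first by apply: cvgD; [exact: cvg_cst|exact: cvg_id].
by apply: cvg_norm; apply: cvgB; [exact: cvg_cst|exact: cvg_id].
Qed.

(** Suppose [P x0 < P x1], with mean [m], and test with a plateau that rises just after [x0] and
    falls just before [x1]. Then [(m - P) * a'] is nonnegative and somewhere positive, yet its
    integral is 0, because [a'] itself integrates to 0. The reverse inequality will come from the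
    same statement for [- P]. *)
Lemma weak_derivative0_le lo hi P : continuous P ->
  (forall a a', bump lo hi a a' -> integ lo hi (fun x => P x * a' x) = 0) ->
  forall x0 x1, lo < x0 -> x0 < x1 -> x1 < hi -> P x1 <= P x0.
Proof.
move=> cP H x0 x1 l0 x01 h1; rewrite leNgt; apply/negP => P01.
pose m := (P x0 + P x1) / 2.
have [d0 d0p P0] : exists2 d, 0 < d & forall x, `|x0 - x| < d -> P x < m.
  have /(cvgr_lt _ (cP x0))/nbhs_ballP[d d0 hd] : P x0 < m by rewrite /m; lra.
  by exists d => // x; exact: hd.
have [d1 d1p P1] : exists2 d, 0 < d & forall x, `|x1 - x| < d -> m < P x.
  have /(cvgr_gt _ (cP x1))/nbhs_ballP[d d1 hd] : m < P x1 by rewrite /m; lra.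
  by exists d => // x; exact: hd.
(* [d0] and [d1] keep [P] on its side of [m] along the two ramps; a third of the gap keeps the ramps
   apart. *)
pose d := Num.min (Num.min (d0 / 2) (d1 / 2)) ((x1 - x0) / 3).
have dp : 0 < d by rewrite !lt_min !divr_gt0//= subr_gt0.
have dd0 : d < d0 by rewrite /d !gt_min; apply/orP; left; apply/orP; left; lra.
have dd1 : d < d1 by rewrite /d !gt_min; apply/orP; left; apply/orP; right; lra.
have dx : d <= (x1 - x0) / 3 by rewrite /d ge_min lexx orbT.
have [|a [a' [sa da az [ar af] [c cc ac]]]] := plateau x0 x1 d dp; first lra.
have ba : bump lo hi a a' by split => //; exists x0, x1.
have [ca ca'] := bump_continuous _ _ _ _ ba.
have cPm : continuous (fun x => m - P x) by apply: continuous_funB => //;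
  exact: cst_continuous.
have lh : lo < hi by lra.
have I0 : integ lo hi (fun x => (m - P x) * a' x) = 0.
  transitivity (integ lo hi (fun x => a' x * m) - integ lo hi (fun x => P x * a' x)).
    rewrite -integB; [|by apply: continuous_funM => //; exact: cst_continuous|exact: continuous_funM].
    by apply: eq_integ => x _; ring.
  rewrite (H _ _ ba) subr0 integZr// (integ_FTC2 _ a)//.
  by rewrite (az lo _).1 ?(az hi _).1 ?subrr ?mul0r//; [right|left]; exact: ltW.
suff : 0 < integ lo hi (fun x => (m - P x) * a' x) by rewrite I0 ltxx.
apply: (integ_gt0 _ _ _ c); first exact: continuous_funM.
- move=> x _; have [h|h] := leP x x0; first by rewrite (az x _).2 ?mulr0//; left.
  have [h'|h'] := leP x1 x; first by rewrite (az x _).2 ?mulr0//; right.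
  have [k|k] := leP x (x0 + d).
    rewrite mulr_ge0//; last by apply: ar; lra.
    by rewrite subr_ge0 ltW// P0// ltr0_norm; lra.
  have [k'|k'] := leP (x1 - d) x.
    rewrite mulr_le0// ?af// subr_le0 ltW// P1// gtr0_norm; lra.
  suff -> : a' x = 0 by rewrite mulr0.
  by apply/eqP; rewrite eq_le af// ar.
- lra.
- by rewrite mulr_gt0// subr_gt0 P0// ltr0_norm; lra.
Qed.

(** If [Q] is a primitive of [B], then [B * a + Q * a'] is the derivative of [Q * a] and integrates
    to 0. So [A - Q] has weak derivative 0, and the previous lemma for it and its opposite makes it
    constant. *)
Lemma weak_derivative_integ lo hi A B : continuous A -> continuous B ->
  (forall a a', bump lo hi a a' -> integ lo hi (fun x => A x * a' x + B x * a x) = 0) ->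
  forall x0 x1, lo < x0 -> x0 <= x1 -> x1 < hi -> A x1 - A x0 = integ x0 x1 B.
Proof.
move=> cA cB H x0 x1 l0; rewrite le_eqVlt => /predU1P[<-|x01] h1.
  by rewrite integ_point subrr.
(* Starting at [lo - 1] makes [Q] differentiable from both sides at [lo]; freezing it to the left of
   [lo] gives [Qc], continuous on the whole line. *)
pose Q x := integ (lo - 1) x B.
have dQ x : lo <= x -> is_derive x 1 Q (B x).
  by move=> h; apply: integ_FTC1 => //; lra.
pose Qc x := Q (Num.max lo x).
have cQc : continuous Qc.
  move=> x; apply: (@continuous_comp _ _ _ (fun x => Num.max lo x) Q).
    exact: continuous_maxl.
  by apply: is_derive_continuous (dQ _ _); rewrite le_max lexx.
have QcE x : lo <= x -> Qc x = Q x by move=> h; rewrite /Qc (max_idPr h).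
have lh : lo < hi by lra.
have W a a' : bump lo hi a a' -> integ lo hi (fun x => (A x - Qc x) * a' x) = 0.
  move=> ba; have [ca ca'] := bump_continuous _ _ _ _ ba.
  have := H _ _ ba; have [sa da [p [q [lp qh az]]]] := ba => HA.
  have FQ : integ lo hi (fun x => B x * a x + Qc x * a' x) = 0.
    have cF : continuous (fun x => B x * a x + Qc x * a' x).
      by apply: continuous_funD; exact: continuous_funM.
    have dF x : lo <= x <= hi ->
        is_derive x 1 (fun x => Q x * a x) (B x * a x + Qc x * a' x).
      move=> /andP[lx _]; apply: is_derive_eq (is_deriveM (dQ _ lx) (da x)) _.
      by rewrite QcE// /GRing.scale/=; ring.
    rewrite (integ_FTC2 _ _ _ _ lh cF dF).
    by rewrite (az hi _).1 ?(az lo _).1 ?mulr0 ?subrr//; [left|right]; exact: ltW.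
  transitivity (integ lo hi (fun x => A x * a' x + B x * a x) -
      integ lo hi (fun x => B x * a x + Qc x * a' x)).
    rewrite -integB; [|by apply: continuous_funD; exact: continuous_funM..].
    by apply: eq_integ => x _; ring.
  by rewrite HA FQ subrr.
have cP : continuous (fun x => A x - Qc x) by exact: continuous_funB.
have E1 := weak_derivative0_le lo hi _ cP W x0 x1 l0 x01 h1.
have cPN : continuous (fun x => Qc x - A x) by exact: continuous_funB.
have WN a a' : bump lo hi a a' -> integ lo hi (fun x => (Qc x - A x) * a' x) = 0.
  move=> ba; have [_ ca'] := bump_continuous _ _ _ _ ba.
  transitivity (integ lo hi (fun x => (A x - Qc x) * a' x * (-1))).
    by apply: eq_integ => x _; ring.
  by rewrite integZr; [rewrite (W _ _ ba) mul0r|exact: continuous_funM].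
have E2 := weak_derivative0_le lo hi _ cPN WN x0 x1 l0 x01 h1.
have E3 : Q x1 = Q x0 + integ x0 x1 B by apply: integ_split => //; lra.
move: E1 E2; rewrite !QcE; lra.
Qed.

End Weak1D.

(** * Tensor test functions and the divergence identity on rectangles *)

Section TestFunctions.
Context {R : realType}.
Implicit Types (a b : R -> R) (p : R * R).

Lemma continuous_fst_comp a : continuous a -> continuous (fun p => a p.1).
Proof.
by move=> ca p; apply: (@continuous_comp _ _ _ fst a); [exact: cvg_fst|exact: ca].
Qed.

Lemma continuous_snd_comp a : continuous a -> continuous (fun p => a p.2).
Proof.
by move=> ca p; apply: (@continuous_comp _ _ _ snd a); [exact: cvg_snd|exact: ca].
Qed.

Lemma is_derive_cvg (f : R -> R) (x l : R) : is_derive x 1 f l ->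
  h^-1 *: ((f \o shift x) (h *: 1) - f x) @[h --> 0^'] --> l.
Proof. by case=> cv <-. Qed.

Lemma is_derive_tensor1 a b p (a1 : R) : is_derive p.1 1 a a1 ->
  is_derive p (1, 0) (fun p => a p.1 * b p.2) (a1 * b p.2).
Proof.
move=> /is_derive_cvg cv.
have : h^-1 *: ((a \o shift p.1) (h *: 1) - a p.1) * b p.2 @[h --> 0^']
   --> a1 * b p.2 by apply: cvgM => //; exact: cvg_cst.
rewrite [X in X @ _ --> _](_ : _ = (fun h : R => h^-1 *:
  (((fun p => a p.1 * b p.2) \o shift p) (h *: (1, 0)) - a p.1 * b p.2))).
  move=> cv'; apply: DeriveDef; last exact: cvg_lim cv'.
  by apply/cvg_ex; exists (a1 * b p.2).
apply/funext => h /=; rewrite scaler0 add0r /GRing.scale/=; ring.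
Qed.

Lemma is_derive_tensor2 a b p (b1 : R) : is_derive p.2 1 b b1 ->
  is_derive p (0, 1) (fun p => a p.1 * b p.2) (a p.1 * b1).
Proof.
move=> /is_derive_cvg cv.
have : a p.1 * (h^-1 *: ((b \o shift p.2) (h *: 1) - b p.2)) @[h --> 0^']
   --> a p.1 * b1 by apply: cvgM => //; exact: cvg_cst.
rewrite [X in X @ _ --> _](_ : _ = (fun h : R => h^-1 *:
  (((fun p => a p.1 * b p.2) \o shift p) (h *: (0, 1)) - a p.1 * b p.2))).
  move=> cv'; apply: DeriveDef; last exact: cvg_lim cv'.
  by apply/cvg_ex; exists (a p.1 * b1).
apply/funext => h /=; rewrite scaler0 add0r /GRing.scale/=; ring.
Qed.

Lemma dx_tensor a b a' : (forall x : R, is_derive x 1 a (a' x)) ->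
  dx (fun p => a p.1 * b p.2) = (fun p => a' p.1 * b p.2).
Proof.
by move=> da; apply/funext => p; have [_] := is_derive_tensor1 _ b _ _ (da p.1).
Qed.

Lemma dy_tensor a b b' : (forall x : R, is_derive x 1 b (b' x)) ->
  dy (fun p => a p.1 * b p.2) = (fun p => a p.1 * b' p.2).
Proof.
by move=> db; apply/funext => p; have [_] := is_derive_tensor2 a _ _ _ (db p.2).
Qed.

(** Both partial derivatives of a tensor product are again tensor products of smooth functions,
    which closes the induction. *)
Lemma C_plane_tensor k a b : smooth a -> smooth b ->
  C_plane k (fun p => a p.1 * b p.2).
Proof.
elim: k a b => [|k IH] a b sa sb.
  by apply: continuous_funM; [apply: continuous_fst_comp|apply: continuous_snd_comp];
    exact: smooth_continuous.
have [a' da sa'] := smooth_derive _ sa; have [b' db sb'] := smooth_derive _ sb.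
split.
- by apply: continuous_funM; [apply: continuous_fst_comp|apply: continuous_snd_comp];
    exact: smooth_continuous.
- move=> p; split; first by case: (is_derive_tensor1 _ b _ _ (da p.1)).
  by case: (is_derive_tensor2 a _ _ _ (db p.2)).
- by rewrite (dx_tensor _ _ _ da); exact: IH.
- by rewrite (dy_tensor _ _ _ db); exact: IH.
Qed.

Lemma test_function_tensor Omega al be c d a a' b b' :
  `[al, be] `*` `[c, d] `<=` Omega -> bump al be a a' -> bump c d b b' ->
  test_function Omega (fun p => a p.1 * b p.2).
Proof.
move=> sub [sa da [p1 [q1 [lp1 qh1 a0]]]] [sb db [p2 [q2 [lp2 qh2 b0]]]].
pose S := [set p : R * R | a p.1 * b p.2 != 0]; pose K : set (R * R) := `[p1, q1] `*` `[p2, q2].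
have cK : compact K by apply: compact_setX; exact: segment_compact.
have clK : closed K.
  apply: compact_closed => //; exact: norm_hausdorff.
have SK : closure S `<=` K.
  rewrite closureE => z; apply; split => // -[u v]; rewrite /S/= => uv.
  have [au bv] : a u != 0 /\ b v != 0.
    by apply/andP; rewrite -negb_or -mulf_eq0.
  split; rewrite /= in_itv/=; apply/andP; split; rewrite leNgt; apply/negP => h.
  - by rewrite (a0 u (or_introl (ltW h))).1 eqxx in au.
  - by rewrite (a0 u (or_intror (ltW h))).1 eqxx in au.
  - by rewrite (b0 v (or_introl (ltW h))).1 eqxx in bv.
  - by rewrite (b0 v (or_intror (ltW h))).1 eqxx in bv.
split.
- by move=> k; exact: C_plane_tensor.
- by apply: (subclosed_compact _ cK SK); exact: closed_closure.
- move=> z /SK; rewrite /K => -[]; rewrite /= !in_itv/= => /andP[h1 h2] /andP[h3 h4].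
  apply: sub; split; rewrite /= in_itv/=; apply/andP; split; lra.
Qed.

End TestFunctions.

(** * The divergence identity from the weak equation *)

Section Divergence.
Context {R : realType}.
Implicit Types (F : R * R -> R) (al be c d : R).

(** The fluxes through the vertical sides stay under the integral in [y] with the area term: the
    identity reads as an increment in [y] of the horizontal flux, the form in which the weak
    derivative in [y] delivers it. *)
Definition div_rect F1 F2 F3 al be c d := forall x0 x1 y0 y1,
  al < x0 -> x0 <= x1 -> x1 < be -> c < y0 -> y0 <= y1 -> y1 < d ->
  integ x0 x1 (fun x => F2 (x, y1)) - integ x0 x1 (fun x => F2 (x, y0)) =
  integ y0 y1 (fun y => integ x0 x1 (fun x => F3 (x, y)) - F1 (x1, y) + F1 (x0, y)).

Lemma integ_param_continuous2 (G : R * R -> R) c d : continuous G ->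
  continuous (fun y => integ c d (fun x => G (x, y))).
Proof. by move=> cG; exact: (integ_param_continuous1 _ _ _ (continuous_swap _ cG)). Qed.

(** For fixed [b], the equation says that [A] has weak derivative [B] in [x]. Integrating from [x0]
    to [x1] eliminates [a]; what remains holds for every [b] and says that the flux [C] has weak
    derivative [D y - F1 (x1, y) + F1 (x0, y)] in [y]. *)
Lemma weak_div_rect F1 F2 F3 al be c d :
  continuous F1 -> continuous F2 -> continuous F3 ->
  (forall a a' b b', bump al be a a' -> bump c d b b' ->
    integ al be (fun x => integ c d (fun y => F1 (x, y) * (a' x * b y) + F2 (x, y) * (a x * b' y)))
    + integ al be (fun x => integ c d (fun y => F3 (x, y) * (a x * b y))) = 0) ->
  div_rect F1 F2 F3 al be c d.
Proof.
move=> cF1 cF2 cF3 H x0 x1 y0 y1 h1 h2 h3 h4 h5 h6.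
pose C y := integ x0 x1 (fun x => F2 (x, y)).
pose D y := integ x0 x1 (fun x => F3 (x, y)).
have cC : continuous C by exact: integ_param_continuous2.
have cD : continuous D by exact: integ_param_continuous2.
have cE : continuous (fun y => D y - F1 (x1, y) + F1 (x0, y)).
  by apply: continuous_funD; [apply: continuous_funB => //|]; exact: continuous_slice2.
apply: (weak_derivative_integ c d C _ cC cE) => // b b' bb.
have [cb cb'] := bump_continuous _ _ _ _ bb.
pose G1 p := F1 p * b p.2; pose G2 p := F2 p * b' p.2 + F3 p * b p.2.
have cG1 : continuous G1 by apply: continuous_funM => //; exact: continuous_snd_comp.
have cG2 : continuous G2.
  by apply: continuous_funD; apply: continuous_funM => //;
    exact: continuous_snd_comp.
pose A x := integ c d (fun y => G1 (x, y));
  pose B x := integ c d (fun y => G2 (x, y)).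
have cA : continuous A by exact: integ_param_continuous1.
have cB : continuous B by exact: integ_param_continuous1.
have AB : A x1 - A x0 = integ x0 x1 B.
  apply: (weak_derivative_integ al be A B cA cB) => // a a' ba.
  have [ca ca'] := bump_continuous _ _ _ _ ba.
  have := H _ _ _ _ ba bb.
  have cH1 : continuous (fun p : R * R => F1 p * (a' p.1 * b p.2) + F2 p * (a p.1 * b' p.2)).
    by apply: continuous_funD; apply: continuous_funM => //; apply: continuous_funM;
      [exact: continuous_fst_comp|exact: continuous_snd_comp
      |exact: continuous_fst_comp|exact: continuous_snd_comp].
  have cH2 : continuous (fun p : R * R => F3 p * (a p.1 * b p.2)).
    by apply: continuous_funM => //; apply: continuous_funM;
      [exact: continuous_fst_comp|exact: continuous_snd_comp].
  rewrite -integD; [|exact: (integ_param_continuous1 _ _ _ cH1)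
                  |exact: (integ_param_continuous1 _ _ _ cH2)].
  move=> <-; apply: eq_integ => x _.
  rewrite -integD; [|exact: (continuous_slice2 _ _ cH1)|exact: (continuous_slice2 _ _ cH2)].
  rewrite -!integZr; [|exact: continuous_slice2..].
  rewrite -integD.
  - by apply: eq_integ => y _; rewrite /G1 /G2/=; ring.
  - by apply: continuous_funM; [exact: continuous_slice2|exact: cst_continuous].
  - by apply: continuous_funM; [exact: continuous_slice2|exact: cst_continuous].
have BE : integ x0 x1 B = integ c d (fun y => C y * b' y + D y * b y).
  rewrite (integ_swap G2)//; apply: eq_integ => y _.
  rewrite -!integZr; [|exact: continuous_slice1..].
  by rewrite -integD//; apply: continuous_funM;
    [exact: continuous_slice1|exact: cst_continuous
    |exact: continuous_slice1|exact: cst_continuous].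
transitivity (integ c d (fun y => C y * b' y + D y * b y) -
    (integ c d (fun y => G1 (x1, y)) - integ c d (fun y => G1 (x0, y)))).
  rewrite -!integB.
  - by apply: eq_integ => y _; rewrite /G1/=; ring.
  - by apply: continuous_funD; exact: continuous_funM.
  - by apply: continuous_funB; exact: continuous_slice2.
  - exact: continuous_slice2.
  - exact: continuous_slice2.
by rewrite -BE -AB subrr.
Qed.

End Divergence.

(** * Restriction of the weak equation to a rectangle *)

Section WeakForm.
Context {R : realType}.
Implicit Types (F : R * R -> R) (al be c d : R) (Omega : set (R * R)).

Definition clamp al be (t : R) := Num.max al (Num.min be t).

Lemma clamp_id al be t : al <= t <= be -> clamp al be t = t.
Proof. by move=> /andP[h1 h2]; rewrite /clamp (min_idPr h2) (max_idPr h1). Qed.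

Lemma clamp_itv al be t : al <= be -> al <= clamp al be t <= be.
Proof. by move=> h; rewrite /clamp le_max lexx/= ge_max h ge_min lexx. Qed.

Lemma continuous_clamp al be : continuous (clamp al be).
Proof.
move=> t; apply: (@continuous_comp _ _ _ (fun t => Num.min be t) (fun t => Num.max al t)).
  exact: continuous_minl.
exact: continuous_maxl.
Qed.

(** Composition with the retraction onto a rectangle: data continuous on [Omega] only become
    continuous on the plane, with the same values on the rectangle. *)
Definition clamp2 al be c d F (p : R * R) := F (clamp al be p.1, clamp c d p.2).

Lemma clamp2_id al be c d F u v : al <= u <= be -> c <= v <= d ->
  clamp2 al be c d F (u, v) = F (u, v).
Proof. by move=> hu hv; rewrite /clamp2/= !clamp_id. Qed.

Lemma continuous_clamp2 Omega al be c d F : open Omega -> al <= be -> c <= d ->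
  `[al, be] `*` `[c, d] `<=` Omega -> {within Omega, continuous F} ->
  continuous (clamp2 al be c d F).
Proof.
move=> oO ab cd sub; rewrite continuous_open_subspace// => cF p.
apply: continuous_for_pair.
- by apply: continuous_comp; [exact: cvg_fst|exact: continuous_clamp].
- by apply: continuous_comp; [exact: cvg_snd|exact: continuous_clamp].
- by apply: cF; rewrite inE; apply: sub; split; rewrite /= in_itv/=;
  exact: clamp_itv.
Qed.

Lemma integral_domain_rect Omega al be c d (f g : R * R -> R) :
  `[al, be] `*` `[c, d] `<=` Omega -> continuous g ->
  (forall u v, al <= u <= be -> c <= v <= d -> f (u, v) = g (u, v)) ->
  (forall u v, ~ (al <= u <= be /\ c <= v <= d) -> f (u, v) = 0) ->
  (\int[lebesgue_measure \x lebesgue_measure]_(p in Omega) (f p)%:E =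
   (integ al be (fun x => integ c d (fun y => g (x, y))))%:E)%E.
Proof.
move=> sub cg fg f0; rewrite -integral_rectE// integral_mkcond [RHS]integral_mkcond.
apply: eq_integral => -[u v] _; rewrite !patchE.
have [huv|huv] := pselect (al <= u <= be /\ c <= v <= d).
  have K : (`[al, be] `*` `[c, d])%classic (u, v) by rewrite /= !in_itv.
  by rewrite (mem_set (sub _ K)) (mem_set K) fg; case: huv.
rewrite (f0 _ _ huv) [X in _ = if X then _ else _](_ : _ = false); first by case: ifP.
by apply/negbTE/negP => /set_mem; rewrite /= !in_itv.
Qed.

(** On the rectangle the clamped data are the given ones; off it one factor of the tensor product
    vanishes with its derivative, and both integrands with it. *)
Lemma weak_form_div_rect Omega (H theta : R * R -> R) al be c d :
  open Omega -> {within Omega, continuous H} -> {within Omega, continuous theta} ->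
  (forall phi : R * R -> R, test_function Omega phi ->
    (\int[lebesgue_measure \x lebesgue_measure]_(p in Omega)
        (cos (theta p) * dx phi p + sin (theta p) * dy phi p)%:E
     + \int[lebesgue_measure \x lebesgue_measure]_(p in Omega) (H p * phi p)%:E = 0)%E) ->
  al <= be -> c <= d -> `[al, be] `*` `[c, d] `<=` Omega ->
  div_rect (fun p => cos (clamp2 al be c d theta p))
    (fun p => sin (clamp2 al be c d theta p)) (clamp2 al be c d H) al be c d.
Proof.
move=> oO cH cth weak ab cd sub.
have cth' := continuous_clamp2 _ _ _ _ _ _ oO ab cd sub cth.
have cH' := continuous_clamp2 _ _ _ _ _ _ oO ab cd sub cH.
have cC : continuous (fun p => cos (clamp2 al be c d theta p)).
  by move=> p; apply: continuous_comp; [exact: cth'|exact: continuous_cos].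
have cS : continuous (fun p => sin (clamp2 al be c d theta p)).
  by move=> p; apply: continuous_comp; [exact: cth'|exact: continuous_sin].
apply: weak_div_rect => // a a' b b' ba bb.
have [ca ca'] := bump_continuous _ _ _ _ ba.
have [cb cb'] := bump_continuous _ _ _ _ bb.
have := weak _ (test_function_tensor _ _ _ _ _ _ _ _ _ sub ba bb).
have [_ da [p1 [q1 [lp1 qh1 a0]]]] := ba; have [_ db [p2 [q2 [lp2 qh2 b0]]]] := bb.
rewrite (dx_tensor _ _ _ da) (dy_tensor _ _ _ db).
have off u v : ~ (al <= u <= be /\ c <= v <= d) ->
    (a u = 0 /\ a' u = 0) \/ (b v = 0 /\ b' v = 0).
  have [u1|u1] := leP u p1; first by left; apply: a0; left.
  have [u2|u2] := leP q1 u; first by left; apply: a0; right.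
  have [v1|v1] := leP v p2; first by right; apply: b0; left.
  have [v2|v2] := leP q2 v; first by right; apply: b0; right.
  by case; split; apply/andP; split; lra.
have ct (f g : R -> R) : continuous f -> continuous g ->
    continuous (fun p : R * R => f p.1 * g p.2).
  by move=> cf cg; apply: continuous_funM;
    [exact: continuous_fst_comp|exact: continuous_snd_comp].
rewrite (@integral_domain_rect Omega al be c d _ (fun p =>
    cos (clamp2 al be c d theta p) * (a' p.1 * b p.2) +
    sin (clamp2 al be c d theta p) * (a p.1 * b' p.2)))//; first last.
- by move=> u v /off[[/= -> ->]|[/= -> ->]]; rewrite !(mul0r, mulr0) addr0.
- by move=> u v hu hv; rewrite !clamp2_id.
- by apply: continuous_funD; apply: continuous_funM => //; exact: ct.
rewrite (@integral_domain_rect Omega al be c d _ (fun p =>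
    clamp2 al be c d H p * (a p.1 * b p.2)))//; first last.
- by move=> u v /off[[/= -> _]|[/= -> _]]; rewrite !(mul0r, mulr0).
- by move=> u v hu hv; rewrite !clamp2_id.
- by apply: continuous_funM => //; exact: ct.
by rewrite -EFinD => -[].
Qed.

(** Reflection in the diagonal, by which the argument for vertical translates also covers horizontal
    ones. *)
Lemma div_rect_swap (F1 F2 F3 : R * R -> R) al be c d :
  continuous F1 -> continuous F2 -> continuous F3 ->
  div_rect F1 F2 F3 al be c d ->
  div_rect (fun p => F2 (p.2, p.1)) (fun p => F1 (p.2, p.1))
    (fun p => F3 (p.2, p.1)) c d al be.
Proof.
move=> c1 c2 c3 HD u0 u1 v0 v1 h1 h2 h3 h4 h5 h6 /=.
have := HD v0 v1 u0 u1 h4 h5 h6 h1 h2 h3.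
have cD : continuous (fun y => integ v0 v1 (fun x => F3 (x, y))).
  exact: integ_param_continuous2.
have cE : continuous (fun x => integ u0 u1 (fun y => F3 (x, y))).
  exact: integ_param_continuous1.
rewrite integD; [|by apply: continuous_funB => //; exact: continuous_slice2|exact: continuous_slice2].
rewrite (integB _ _ _ _ cD); last exact: continuous_slice2.
rewrite integD; [|by apply: continuous_funB => //; exact: continuous_slice1|exact: continuous_slice1].
rewrite (integB _ _ _ _ cE); last exact: continuous_slice1.
by rewrite (integ_swap F3)//; lra.
Qed.

End WeakForm.

(** * Calibration by translates of a characteristic curve *)

Section Calculus.
Context {R : realType}.
Implicit Types (f : R -> R) (x : R).

Lemma dist_between (a b m z e : R) : `|a - m| < e -> `|b - m| < e ->
  a <= z -> z <= b -> `|z - m| < e.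
Proof. by rewrite !ltr_distl => /andP[? ?] /andP[? ?] ? ?; apply/andP; split; lra. Qed.

Lemma dist_lt_itv (a b m z : R) : `|z - m| < Num.min (m - a) (b - m) ->
  a < z < b.
Proof.
by rewrite lt_min !ltr_distl => /andP[/andP[? ?] /andP[? ?]]; apply/andP; split; lra.
Qed.

Lemma is_derive_eps_dist f x (l : R) : is_derive x 1 f l ->
  forall e, 0 < e -> exists2 d, 0 < d &
    forall h, `|h| < d -> `|f (x + h) - f x - l * h| <= e * `|h|.
Proof.
move=> /is_derive_cvg cv e e0; have /cvgrPdist_le/(_ e e0) := cv.
move=> /nbhs_ballP[d /= d0 hd]; exists d => // h hh.
have [->|h0] := eqVneq h 0; first by rewrite addr0 subrr mulr0 subr0 normr0 mulr0.
have := hd h; rewrite /ball/= sub0r normrN => /(_ hh h0).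
have -> : l - h^-1 *: (f (h *: 1 + x) - f x) =
    - (h^-1 * (f (x + h) - f x - l * h)).
  by rewrite /GRing.scale/= mulr1 [h + x]addrC; field.
by rewrite normrN normrM normfV ler_pdivrMl ?normr_gt0// [X in _ <= X]mulrC.
Qed.

(** Stated through distances so that increments of either sign, such as translations by [t], need no
    case distinction. *)
Lemma MVT_dist f (df : R -> R) x y :
  (forall z, `|z - x| <= `|y - x| -> is_derive z 1 f (df z)) ->
  exists2 z, `|z - x| <= `|y - x| & f y - f x = df z * (y - x).
Proof.
move=> D; have [xy|yx|<-] := ltgtP x y; last first.
- by exists x => //; rewrite !subrr mulr0.
- have D' z : y <= z <= x -> is_derive z 1 f (df z).
    move=> /andP[yz zx]; apply: D; rewrite !ler0_norm; lra.
  have [||c] := @MVT R f df y x yx.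
  + by move=> z; rewrite in_itv/= => /andP[h1 h2]; apply: D'; rewrite !ltW.
  + apply: continuous_in_subspaceT => z; rewrite inE/= in_itv/= => hz.
    exact: is_derive_continuous (D' z hz).
  + rewrite in_itv/= => /andP[h1 h2] E; exists c; last by rewrite -opprB E; ring.
    rewrite !ler0_norm; lra.
- have D' z : x <= z <= y -> is_derive z 1 f (df z).
    move=> /andP[yz zx]; apply: D; rewrite !ger0_norm; lra.
  have [||c] := @MVT R f df x y xy.
  + by move=> z; rewrite in_itv/= => /andP[h1 h2]; apply: D'; rewrite !ltW.
  + apply: continuous_in_subspaceT => z; rewrite inE/= in_itv/= => hz.
    exact: is_derive_continuous (D' z hz).
  + rewrite in_itv/= => /andP[h1 h2] E; exists c; last by rewrite E.
    rewrite !ger0_norm; lra.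
Qed.

Lemma continuous_eps2 (g : R * R -> R) (p : R * R) :
  {for p, continuous g} -> forall e, 0 < e -> exists2 d, 0 < d &
  forall u v, `|u - p.1| < d -> `|v - p.2| < d -> `|g (u, v) - g p| < e.
Proof.
move=> cg e e0.
have /(cvgrPdist_lt)/(_ e e0)/nbhs_ballP[d /= d0 hd] := cg.
exists d => // u v hu hv; rewrite distrC; apply: hd.
by split; rewrite /ball/= distrC.
Qed.

Lemma continuous_eps1 f x : {for x, continuous f} ->
  forall e, 0 < e -> exists2 d, 0 < d & forall u, `|u - x| < d -> `|f u - f x| < e.
Proof.
move=> cg e e0.
have /(cvgrPdist_lt)/(_ e e0)/nbhs_ballP[d /= d0 hd] := cg.
by exists d => // u hu; rewrite distrC; apply: hd; rewrite /ball/= distrC.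
Qed.

(* Only [V_y] needs to be continuous: the increment is split so that [V_x] is
   used along a single horizontal line. *)
Lemma chain_rule_plane (V : R -> R -> R) (p : R) (q : R * R -> R)
    (x y : R -> R) (s x1 y1 r : R) : 0 < r ->
  (forall u v, `|u - x s| < r -> `|v - y s| < r -> is_derive v 1 (V u) (q (u, v))) ->
  is_derive (x s) 1 (V ^~ (y s)) p ->
  {for (x s, y s), continuous q} ->
  is_derive s 1 x x1 -> is_derive s 1 y y1 ->
  is_derive s 1 (fun t => V (x t) (y t)) (p * x1 + q (x s, y s) * y1).
Proof.
move=> r0 dV dVx cq dx dy.
have dH : is_derive s 1 (fun t => V (x t) (y s)) (p * x1).
  exact: (@is_derive1_comp R (V ^~ (y s)) x s _ _ dVx dx).
set q0 := q (x s, y s).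
apply: is_derive_eps => e e0.
(* [M] bounds the difference quotients of [y] near [s], and [N] exceeds the modulus of [q0]; each of
   the three error terms below then costs a third of [e]. *)
pose M := `|y1| + 1; have M0 : 0 < M by rewrite ltr_wpDl.
pose N := `|q0| + 1; have N0 : 0 < N by rewrite ltr_wpDl.
have e3 : 0 < e / 3 by rewrite divr_gt0.
have [dH0 dH0p HH] := is_derive_eps_dist _ _ _ dH _ e3.
have e3N : 0 < e / 3 / N by rewrite !divr_gt0//; lra.
have [dY dYp HY] := is_derive_eps_dist _ _ _ dy _ e3N.
have [dY1 dY1p HY1] := is_derive_eps_dist _ _ _ dy 1 ltr01.
have e3M : 0 < e / 3 / M by rewrite !divr_gt0//; lra.
have [dq dqp Hq] := continuous_eps2 _ _ cq _ e3M.
have rq : 0 < Num.min r dq by rewrite lt_min r0.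
have [cx cxp Hcx] := continuous_eps1 _ _ (is_derive_continuous _ _ _ dx) _ rq.
have [cy cyp Hcy] := continuous_eps1 _ _ (is_derive_continuous _ _ _ dy) _ rq.
exists (Num.min (Num.min dH0 (Num.min dY dY1)) (Num.min cx cy)).
  by rewrite !lt_min dH0p dYp dY1p cxp cyp.
move=> h; rewrite !lt_min => /andP[/andP[hH /andP[hY hY1]] /andP[hx hy]].
have := Hcx (s + h); rewrite addrAC subrr add0r => /(_ hx);
  rewrite lt_min => /andP[xr xq].
have := Hcy (s + h); rewrite addrAC subrr add0r => /(_ hy);
  rewrite lt_min => /andP[yr yq].
have [|z zy E] := @MVT_dist (V (x (s + h))) (fun v => q (x (s + h), v)) (y s) (y (s + h)).
  by move=> z hz; apply: dV => //; exact: le_lt_trans hz yr.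
have zq := le_lt_trans zy yq.
have Qz := Hq _ _ xq zq.
have K1 : `|y (s + h) - y s| <= M * `|h|.
  have := HY1 _ hY1; rewrite mul1r => k.
  rewrite (_ : _ - _ = (y (s + h) - y s - y1 * h) + y1 * h); last by ring.
  by rewrite (le_trans (ler_normD _ _))// normrM /M mulrDl mul1r addrC lerD2l.
have K2 : `|(q (x (s + h), z) - q0) * (y (s + h) - y s)| <= e / 3 * `|h|.
  rewrite normrM; apply: le_trans (_ : e / 3 / M * (M * `|h|) <= _).
    by apply: ler_pM => //; exact: ltW.
  by rewrite mulrA divfK// gt_eqF.
have K3 : `|q0 * (y (s + h) - y s - y1 * h)| <= e / 3 * `|h|.
  rewrite normrM; apply: le_trans (_ : N * (e / 3 / N * `|h|) <= _).
    by apply: ler_pM => //; [rewrite /N lerDl|exact: HY].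
  by rewrite mulrA [N * _]mulrC divfK// gt_eqF.
have K4 := HH _ hH.
have -> : V (x (s + h)) (y (s + h)) - V (x s) (y s) - (p * x1 + q0 * y1) * h =
   (q (x (s + h), z) - q0) * (y (s + h) - y s) +
   q0 * (y (s + h) - y s - y1 * h) +
   (V (x (s + h)) (y s) - V (x s) (y s) - p * x1 * h).
  have -> : V (x (s + h)) (y (s + h)) =
    V (x (s + h)) (y s) + q (x (s + h), z) * (y (s + h) - y s) by rewrite -E; ring.
  ring.
apply: le_trans (ler_normD _ _) _.
have -> : e * `|h| = e / 3 * `|h| + e / 3 * `|h| + e / 3 * `|h| by field.
by apply: lerD K4; apply: le_trans (ler_normD _ _) _; exact: lerD.
Qed.

End Calculus.

(** * A primitive of the flux *)

Section Potential.
Context {R : realType}.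
Variables (F1 F2 F3 : R * R -> R) (al be c d y0 : R).
Hypotheses (cF1 : continuous F1) (cF2 : continuous F2) (cF3 : continuous F3).
Hypotheses (HD : div_rect F1 F2 F3 al be c d) (cy0 : c < y0).

Let V x y := integ y0 y (fun t => F1 (x, t)).
(** The formal value of [V_x]: the integral of [F1_x = F3 - F2_y] from [y0] to [y]. *)
Let p x y := integ y0 y (fun t => F3 (x, t)) - F2 (x, y) + F2 (x, y0).

Lemma potential_dy x y : y0 < y -> is_derive y 1 (V x) (F1 (x, y)).
Proof. by move=> h; apply: integ_FTC1 => //; exact: continuous_slice2. Qed.

Lemma potential_dx x y : al < x -> x < be -> y0 < y -> y < d ->
  is_derive x 1 (V ^~ y) (p x y).
Proof.
move=> ax xb y0y yd.
(* The primitive in [x] needs a base point strictly left of [x], still in the range of the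
   divergence identity. *)
pose m := (al + x) / 2; have [am mx] : al < m /\ m < x by rewrite /m; split; lra.
have cp : continuous (p ^~ y).
  apply: continuous_funD; last exact: continuous_slice1.
  by apply: continuous_funB;
    [exact: integ_param_continuous1|exact: continuous_slice1].
have E z : m <= z -> z < be -> V z y = V m y + integ m z (p ^~ y).
  move=> mz zb; have := HD m z y0 y am mz zb cy0 (ltW y0y) yd.
  pose D t := integ m z (fun u => F3 (u, t)).
  have cD : continuous D by exact: integ_param_continuous2.
  have -> : integ y0 y (fun t => integ m z (fun u => F3 (u, t)) - F1 (z, t) + F1 (m, t)) =
      integ y0 y D - V z y + V m y.
    rewrite -integB; [|exact: cD|exact: continuous_slice2].
    rewrite -integD//; last exact: continuous_slice2.
    by apply: continuous_funB => //; exact: continuous_slice2.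
  have -> : integ m z (p ^~ y) = integ y0 y D - integ m z (fun u => F2 (u, y)) +
      integ m z (fun u => F2 (u, y0)).
    rewrite /D -(integ_swap F3)// -integB;
      [|exact: integ_param_continuous1|exact: continuous_slice1].
    rewrite -integD//; last exact: continuous_slice1.
    by apply: continuous_funB;
      [exact: integ_param_continuous1|exact: continuous_slice1].
  by move=> h; lra.
have dI := is_deriveD (is_derive_cst (V m y) x (1 : R)) (integ_FTC1 _ _ _ cp mx).
have : is_derive x 1 (fun z => V m y + integ m z (p ^~ y)) (p x y).
  by rewrite add0r in dI; exact: dI.
apply: near_eq_is_derive.
have : \forall z \near x, z \in `]m, be[ by apply: near_in_itvoo; rewrite in_itv/= mx.
by apply: filterS => z; rewrite in_itv/= => /andP[mz zb]; rewrite (E z (ltW mz) zb).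
Qed.

(** [p] contains the merely continuous term [- F2 (x, y)]; adding it back leaves a primitive of
    [F3]. *)
Lemma potential_dyp x y : y0 < y ->
  is_derive y 1 (fun y => p x y + F2 (x, y)) (F3 (x, y)).
Proof.
move=> h.
have -> : (fun y => p x y + F2 (x, y)) =
    (fun y => F2 (x, y0) + integ y0 y (fun t => F3 (x, t))).
  by apply/funext => z; rewrite /p; ring.
have dI := is_deriveD (is_derive_cst (F2 (x, y0)) y (1 : R))
  (integ_FTC1 _ _ _ (continuous_slice2 F3 x cF3) h).
by rewrite add0r in dI; exact: dI.
Qed.

Lemma potential_exists : exists V p : R -> R -> R, forall x y,
  al < x -> x < be -> y0 < y -> y < d ->
  [/\ is_derive y 1 (V x) (F1 (x, y)), is_derive x 1 (V ^~ y) (p x y) &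
      is_derive y 1 (fun y => p x y + F2 (x, y)) (F3 (x, y))].
Proof.
exists V, p => x y h1 h2 h3 h4; split; first exact: potential_dy.
  exact: potential_dx.
exact: potential_dyp.
Qed.

End Potential.

(** * The calibration inequality *)

Section Calibration.
Context {R : realType}.
Variables (F1 F2 F3 : R * R -> R) (al be c d : R).
Hypotheses (cF1 : continuous F1) (cF2 : continuous F2) (cF3 : continuous F3).
Hypothesis unitF : forall p, F1 p ^+ 2 + F2 p ^+ 2 = 1.
Hypothesis HD : div_rect F1 F2 F3 al be c d.

(* The flux of the unit field through the curve translated vertically by [t] is
   at most its length, with equality for [t = 0], while by the divergence
   identity the flux varies by the integral of [F3] over the strip swept. Hence
   the increment of [Z t], the primitive of [F1] across the strip, is bounded
   below to first order in [t] for both signs of [t], which determines the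
   derivative of [F1] along the curve. *)
Lemma calibration (x y : R -> R) (s0 r : R) : 0 < r ->
  (forall s, `|s - s0| < r ->
    is_derive s 1 x (F2 (x s, y s)) /\ is_derive s 1 y (- F1 (x s, y s))) ->
  al < x s0 -> x s0 < be -> c < y s0 -> y s0 < d ->
  is_derive s0 1 (fun s => F1 (x s, y s)) (F3 (x s0, y s0) * F2 (x s0, y s0)).
Proof.
move=> r0 Dxy hax hxb hcy hyd.
pose y0 := (c + y s0) / 2.
have [cy0 y0y] : c < y0 /\ y0 < y s0 by rewrite /y0; split; lra.
have [V [p Vp]] := potential_exists F1 F2 F3 al be c d y0 cF1 cF2 cF3 HD cy0.
set c0 := F3 _ * F2 _.
have cx s : `|s - s0| < r -> {for s, continuous x}.
  by move=> /Dxy[dx _]; exact: is_derive_continuous dx.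
have cy s : `|s - s0| < r -> {for s, continuous y}.
  by move=> /Dxy[_ dy]; exact: is_derive_continuous dy.
have s0r : `|s0 - s0| < r by rewrite subrr normr0.
apply: is_derive_eps => e e0.
(* [F3] gets a height [t] of its own because the mean value point [xi] used below lies off the
   curve. *)
have [rho rho0 Hrho] : exists2 rho, 0 < rho & forall s t, `|s - s0| < rho ->
    `|t - y s0| < rho -> [/\ `|s - s0| < r, al < x s < be, y0 < t < d &
      `|F3 (x s, t) * F2 (x s, y s) - c0| < e].
  pose K (st : R * R) := F3 (x st.1, st.2) * F2 (x st.1, y st.1).
  have cK : {for (s0, y s0), continuous K}.
    have cx1 : {for (s0, y s0), continuous (fun st : R * R => x st.1)}.
      by apply: continuous_comp; [exact: cvg_fst|exact: cx].
    have cy1 : {for (s0, y s0), continuous (fun st : R * R => y st.1)}.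
      by apply: continuous_comp; [exact: cvg_fst|exact: cy].
    apply: continuousM.
      apply: (continuous_for_pair _ _ F3 _ cx1 _ (cF3 _)); exact: cvg_snd.
    exact: (continuous_for_pair _ _ F2 _ cx1 cy1 (cF2 _)).
  have [d1 d1p H1] := continuous_eps2 K _ cK e e0.
  have m0 : 0 < Num.min (x s0 - al) (be - x s0) by rewrite lt_min !subr_gt0 hax.
  have [d2 d2p H2] := continuous_eps1 _ _ (cx s0 s0r) _ m0.
  have m1 : 0 < Num.min (y s0 - y0) (d - y s0) by rewrite lt_min !subr_gt0 y0y.
  exists (Num.min (Num.min d1 d2) (Num.min r (Num.min (y s0 - y0) (d - y s0)))).
    by rewrite !lt_min d1p d2p r0 !subr_gt0 y0y.
  move=> s t; rewrite !(lt_min _ (Num.min d1 d2)) !(lt_min _ d1) !(lt_min _ r).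
  move=> /andP[/andP[k1 k2] /andP[k3 _]] /andP[/andP[k4 _] /andP[_ k5]].
  split => //; first exact: (dist_lt_itv _ _ _ _ (H2 _ k2)).
  - exact: (dist_lt_itv _ _ _ _ k5).
  - exact: H1.
have rho2 : 0 < rho / 2 by lra.
have [dy0 dy0p Hy] := continuous_eps1 _ _ (cy s0 s0r) _ rho2.
pose dd := Num.min rho dy0.
have ddp : 0 < dd by rewrite lt_min rho0.
pose Z t s := V (x s) (y s + t) - V (x s) (y s).
have Zgrow t s s' : `|t| < rho / 2 -> `|s - s0| < dd -> `|s' - s0| < dd -> s <= s' ->
    (c0 * t - e * `|t|) * (s' - s) <= Z t s' - Z t s.
  move=> tr sd sd' ss'.
  have near_y z u : `|z - s0| < dd -> `|u| <= `|t| -> `|z - s0| < rho /\ `|y z + u - y s0| < rho.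
    rewrite lt_min => /andP[z1 /Hy z2] ut; split=> //.
    rewrite (_ : _ - _ = (y z - y s0) + u); last by ring.
    by rewrite (le_lt_trans (ler_normD _ _))//; lra.
  (* The arc and its translate share the velocity [(F2, - F1)] taken on the original curve; only the
     gradient [(p, F1)] of [V] is evaluated at two heights. *)
  pose dZ z := F2 (x z, y z) * (p (x z) (y z + t) - p (x z) (y z)) -
     F1 (x z, y z) * (F1 (x z, y z + t) - F1 (x z, y z)).
  have DZ z : `|z - s0| < dd -> is_derive z 1 (Z t) (dZ z).
    move=> zd.
    have t0 : `|0 : R| <= `|t| by rewrite normr0.
    have [zr zt] := near_y z t zd (lexx _).
    have [_ z0'] := near_y z 0 zd t0; rewrite addr0 in z0'.
    have [zr' /andP[b1 b2] /andP[b3 b4] _] := Hrho _ _ zr zt.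
    have [_ _ /andP[b5 b6] _] := Hrho _ _ zr z0'.
    have [dx dy] := Dxy _ zr'.
    have dyt : is_derive z 1 (fun s => y s + t) (- F1 (x z, y z)).
      by have := is_deriveD dy (is_derive_cst t z (1 : R)); rewrite addr0; exact.
    have box v0 : y0 < v0 -> v0 < d -> exists2 q, 0 < q & forall u v,
        `|u - x z| < q -> `|v - v0| < q -> is_derive v 1 (V u) (F1 (u, v)).
      move=> w1 w2.
      exists (Num.min (Num.min (x z - al) (be - x z)) (Num.min (v0 - y0) (d - v0))).
        by rewrite !lt_min !subr_gt0 b1 b2 w1.
      move=> u v; rewrite lt_min => /andP[/dist_lt_itv/andP[u1 u2] _].
      rewrite lt_min => /andP[_ /dist_lt_itv/andP[v1 v2]].
      by have [] := Vp u v u1 u2 v1 v2.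
    have [q1 q1p B1] := box (y z + t) b3 b4.
    have [q2 q2p B2] := box (y z) b5 b6.
    have [_ Vx1 _] := Vp (x z) (y z + t) b1 b2 b3 b4.
    have [_ Vx2 _] := Vp (x z) (y z) b1 b2 b5 b6.
    have D1 := chain_rule_plane V _ F1 x (fun s => y s + t) z _ _ q1 q1p B1 Vx1 (cF1 _) dx dyt.
    have D2 := chain_rule_plane V _ F1 x y z _ _ q2 q2p B2 Vx2 (cF1 _) dx dy.
    apply: is_derive_eq (is_deriveB D1 D2) _.
    by rewrite /dZ; ring.
  have dZge z : `|z - s0| < dd -> c0 * t - e * `|t| <= dZ z.
    move=> zd.
    pose q v := p (x z) v + F2 (x z, v).
    have [|xi hxi E] := @MVT_dist _ q (fun v => F3 (x z, v)) (y z) (y z + t).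
      move=> v; rewrite [y z + t]addrC addrK => hv.
      have [zr zv] := near_y z (v - y z) zd hv.
      rewrite [y z + _]addrC subrK in zv.
      have [_ /andP[b1 b2] /andP[b3 b4] _] := Hrho _ _ zr zv.
      by have [] := Vp (x z) v b1 b2 b3 b4.
    rewrite [y z + t]addrC addrK in hxi E.
    have [zr zv] := near_y z (xi - y z) zd hxi.
    rewrite [y z + _]addrC subrK in zv.
    have [_ _ _ hK] := Hrho _ _ zr zv.
    set f1 := F1 (x z, y z); set f2 := F2 (x z, y z).
    set g1 := F1 (x z, y z + t); set g2 := F2 (x z, y z + t).
    have uf : f1 ^+ 2 + f2 ^+ 2 = 1 by exact: unitF.
    have ug : g1 ^+ 2 + g2 ^+ 2 = 1 by exact: unitF.
    (* The increment of [p] is [F3 * t] minus that of [F2]; by unit length the remaining terms form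
       one minus a scalar product of unit vectors, nonnegative by Cauchy-Schwarz. Only its sign is
       used. *)
    have -> : dZ z = (F3 (x z, xi) * f2) * t + (1 - (f1 * g1 + f2 * g2)).
      rewrite /dZ -/f1 -/f2 -/g1.
      have -> : p (x z) (y z + t) - p (x z) (y z) = F3 (x z, xi) * t - g2 + f2.
        by move: E; rewrite /q [t + _]addrC -/f2 -/g2; lra.
      by rewrite -uf; ring.
    have cs : f1 * g1 + f2 * g2 <= 1.
      have : 0 <= (f1 - g1) ^+ 2 + (f2 - g2) ^+ 2 by rewrite addr_ge0 ?sqr_ge0.
      rewrite (_ : _ + _ = (f1 ^+ 2 + f2 ^+ 2) + (g1 ^+ 2 + g2 ^+ 2) -
        2 * (f1 * g1 + f2 * g2)); last by ring.
      by rewrite uf ug; lra.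
    have : `|(F3 (x z, xi) * f2 - c0) * t| <= e * `|t|.
      by rewrite normrM ler_wpM2r// ltW.
    rewrite ler_norml => /andP[k _]; move: k; rewrite mulrBl; lra.
  have [| |xi] := @MVT_segment R (Z t) dZ s s' ss'.
  - move=> z; rewrite in_itv/= => /andP[z1 z2]; apply: DZ.
    exact: (dist_between _ _ _ _ _ sd sd' (ltW z1) (ltW z2)).
  - apply: continuous_in_subspaceT => z; rewrite inE/= in_itv/= => /andP[z1 z2].
    apply: is_derive_continuous (DZ z _).
    exact: (dist_between _ _ _ _ _ sd sd' z1 z2).
  - rewrite in_itv/= => /andP[z1 z2] ->; rewrite ler_wpM2r ?subr_ge0//; apply: dZge.
    exact: (dist_between _ _ _ _ _ sd sd' z1 z2).
(* To first order in [t], [Z t s] is [F1 (x s, y s) * t], since [V_y = F1]. *)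
have Zlim s eta : `|s - s0| < dd -> 0 < eta -> exists2 q, 0 < q & forall t, `|t| < q ->
    `|Z t s - F1 (x s, y s) * t| <= eta * `|t|.
  rewrite lt_min => /andP[z1 /Hy z2] eta0.
  have z2' : `|y s - y s0| < rho by lra.
  have [_ /andP[b1 b2] /andP[b3 b4] _] := Hrho _ _ z1 z2'.
  have [D _ _] := Vp (x s) (y s) b1 b2 b3 b4.
  exact: is_derive_eps_dist D _ eta0.
have main s s' : `|s - s0| < dd -> `|s' - s0| < dd -> s <= s' ->
    `|F1 (x s', y s') - F1 (x s, y s) - c0 * (s' - s)| <= e * (s' - s).
  (* The points [s] and [s'] are fixed before [t] is chosen: the expansion of [Z] need not be
     uniform along the curve, and its error goes into [eta]. *)
  move=> sd sd' ss'; apply/ler_addgt0Pr => eta eta0.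
  have eta2 : 0 < eta / 2 by lra.
  have [q qp Hq] := Zlim s _ sd eta2; have [q' qp' Hq'] := Zlim s' _ sd' eta2.
  pose t := Num.min (rho / 2) (Num.min q q') / 2.
  have mp : 0 < Num.min (rho / 2) (Num.min q q') by rewrite !lt_min rho2 qp.
  have t0 : 0 < t by rewrite /t; lra.
  have : t < Num.min (rho / 2) (Num.min q q') by rewrite /t; lra.
  rewrite !lt_min => /andP[tr /andP[tq tq']].
  (* The growth of [Z] for the translation [sg * t], divided by [t]; [sg = 1] gives the lower bound
     and [sg = -1] the upper one. *)
  have key (sg : R) : `|sg| = 1 -> - (e * (s' - s) + eta) <=
      sg * (F1 (x s', y s') - F1 (x s, y s) - c0 * (s' - s)).
    move=> sg1.
    have nt : `|sg * t| = t by rewrite normrM sg1 mul1r gtr0_norm.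
    have := Zgrow (sg * t) s s'; rewrite nt => /(_ tr sd sd' ss').
    have := Hq (sg * t); rewrite nt => /(_ tq); rewrite ler_norml => /andP[k1 _].
    have := Hq' (sg * t); rewrite nt => /(_ tq'); rewrite ler_norml => /andP[_ k2].
    move=> k3; rewrite -(ler_pM2l t0).
    set A := F1 (x s', y s') in k2 *; set B := F1 (x s, y s) in k1 *.
    have -> : t * (sg * (A - B - c0 * (s' - s))) =
      A * (sg * t) - B * (sg * t) - c0 * (sg * t) * (s' - s) by ring.
    move: k1 k2 k3; set z1 := Z _ s; set z2 := Z _ s'; move=> k1 k2.
    rewrite mulrBl => k3.
    have -> : t * - (e * (s' - s) + eta) = - (e * t * (s' - s)) - eta / 2 * t - eta / 2 * t.
      by field.
    lra.
  rewrite ler_norml; apply/andP; split.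
    by have := key 1; rewrite normr1 mul1r; exact.
  by have := key (-1); rewrite normrN1 mulN1r lerN2; exact.
exists dd => // h hd.
have sh : `|s0 + h - s0| < dd by rewrite addrAC subrr add0r.
have ss : `|s0 - s0| < dd by rewrite subrr normr0.
have [h0|h0] := leP 0 h.
  have := main s0 (s0 + h) ss sh; rewrite lerDl => /(_ h0).
  by rewrite [s0 + h - s0]addrAC subrr add0r (ger0_norm h0).
have := main (s0 + h) s0 sh ss; rewrite gerDl => /(_ (ltW h0)).
rewrite opprD addrA subrr sub0r (ltr0_norm h0).
by rewrite -normrN (_ : - (_ - _ - _) = F1 (x (s0 + h), y (s0 + h)) - F1 (x s0, y s0) - c0 * h)//; ring.
Qed.

End Calibration.

(** * Characteristic curves *)

Section Regularity.
Context {R : realType}.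

Lemma near_eq_continuous (f g : R -> R) (s : R) :
  (\forall t \near s, g t = f t) -> {for s, continuous g} -> {for s, continuous f}.
Proof.
move=> fg cg; rewrite /prop_for /continuous_at -(nbhs_singleton fg).
by apply: cvg_trans cg; apply: near_eq_cvg.
Qed.

(** Since [I] is open, the formulas for the derivatives hold in a neighbourhood of each point and
    may be differentiated again. *)
Lemma C_on2_derive (I : set R) (f f1 f2 : R -> R) : open I ->
  (forall s, I s -> is_derive s 1 f (f1 s)) ->
  (forall s, I s -> is_derive s 1 f1 (f2 s)) ->
  (forall s, I s -> {for s, continuous f2}) ->
  [/\ C_on 2 I f, forall s, I s -> derive1 f s = f1 s &
      forall s, I s -> derive1n 2 f s = f2 s].
Proof.
move=> oI df df1 cf2.
have nearI s : I s -> \forall t \near s, I t by move=> Is; exact: open_nbhs_nbhs.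
have E1 s : I s -> derive1 f s = f1 s by move=> /df[_ <-]; rewrite derive1E.
have d1 s : I s -> is_derive s 1 (derive1 f) (f2 s).
  move=> Is; apply: near_eq_is_derive (df1 s Is).
  by apply: filterS (nearI s Is) => t It; rewrite E1.
have E2 s : I s -> derive1n 2 f s = f2 s.
  by move=> Is; rewrite derive1nS derive1n1 derive1E; case: (d1 s Is).
split => //; split.
  case=> [|[|//]] s _ Is; first by case: (df s Is).
  by rewrite derive1n1; case: (d1 s Is).
case=> [|[|[|//]]] s _ Is; first exact: is_derive_continuous (df s Is).
  by rewrite derive1n1; exact: is_derive_continuous (d1 s Is).
apply: near_eq_continuous (cf2 s Is).
by apply: filterS (nearI s Is) => t It; rewrite E2.
Qed.

(** By [cos ^ 2 + sin ^ 2 = 1], [sin (tau t - tau s)] has derivative [- k] at [s]. Continuity of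
    [tau] keeps the difference within [pi / 2], where [asin] undoes the sine, and [asin] has
    derivative 1 at 0. *)
Lemma is_derive_angle (tau : R -> R) (s k : R) : {for s, continuous tau} ->
  is_derive s 1 (fun t => cos (tau t)) (k * sin (tau s)) ->
  is_derive s 1 (fun t => sin (tau t)) (- (k * cos (tau s))) ->
  is_derive s 1 tau (- k).
Proof.
move=> ctau dc ds.
pose g t := sin (tau t - tau s).
have dg : is_derive s 1 g (- k).
  have -> : g = (fun t => sin (tau t) * cos (tau s) - cos (tau t) * sin (tau s)).
    by apply/funext => t; rewrite /g sinB.
  have e1 := is_deriveM ds (is_derive_cst (cos (tau s)) s (1 : R)).
  have e2 := is_deriveM dc (is_derive_cst (sin (tau s)) s (1 : R)).
  apply: is_derive_eq (is_deriveB e1 e2) _.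
  rewrite /GRing.scale/= !mulr0 !add0r -[RHS]mulr1 -(cos2Dsin2 (tau s)).
  ring.
have g0 : g s = 0 by rewrite /g subrr sin0.
have da : is_derive (g s) 1 (@asin R) 1.
  have := @is_derive1_asin R (g s); rewrite g0 => /(_ _)/is_derive_eq; apply.
    by rewrite ltrN10 ltr01.
  by rewrite expr0n/= subr0 sqrtr1 invr1.
have db := is_derive1_comp da dg; rewrite mul1r in db.
have dd := is_deriveD (is_derive_cst (tau s) s (1 : R)) db; rewrite add0r in dd.
apply: near_eq_is_derive dd.
have pi2 : 0 < pi / 2 :> R by rewrite divr_gt0// pi_gt0.
have /cvgrPdist_lt/(_ _ pi2) := ctau.
apply: filterS => t; rewrite distrC ltr_norml => /andP[h1 h2].
rewrite !fctE /= /g sinK; first by rewrite addrC subrK.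
by rewrite in_itv/= !ltW.
Qed.

Lemma is_derive_reverse (f : R -> R) (s l : R) :
  is_derive (- s) 1 f l -> is_derive s 1 (fun t => f (- t)) (- l).
Proof.
move=> df; have dn := is_deriveN (is_derive_id s (1 : R)).
have := @is_derive1_comp R f (fun t => - t) s _ _ df dn.
by rewrite mulrN1; exact.
Qed.

Lemma characteristic_angle (Omega : set (R * R)) (H theta : R * R -> R)
    (I : set R) (x y : R -> R) :
  open Omega -> {within Omega, continuous H} -> {within Omega, continuous theta} ->
  (forall phi : R * R -> R, test_function Omega phi ->
    (\int[lebesgue_measure \x lebesgue_measure]_(p in Omega)
        (cos (theta p) * dx phi p + sin (theta p) * dy phi p)%:E
     + \int[lebesgue_measure \x lebesgue_measure]_(p in Omega) (H p * phi p)%:E = 0)%E) ->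
  characteristic_curve Omega theta I x y ->
  forall s, I s -> is_derive s 1 (fun t => theta (x t, y t)) (- H (x s, y s)).
Proof.
move=> oO cH cth weak [[_ oI _] _ IO dx dy] s0 Is0.
have Op := IO s0 Is0.
have cthO : {in Omega, continuous theta} by rewrite -continuous_open_subspace.
have cx s : I s -> {for s, continuous x}.
  by move=> Is; exact: is_derive_continuous (dx s Is).
have cy s : I s -> {for s, continuous y}.
  by move=> Is; exact: is_derive_continuous (dy s Is).
have /nbhs_ballP[e /= e0 eO] : nbhs (x s0, y s0) Omega by exact: open_nbhs_nbhs.
(* Half the radius keeps the closed rectangle inside the open ball, which is a square for the sup
   norm. *)
pose r := e / 2; have r0 : 0 < r by rewrite /r; lra.
pose al := x s0 - r; pose be := x s0 + r; pose c := y s0 - r; pose d := y s0 + r.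
have ab : al <= be by rewrite /al /be; lra.
have cd : c <= d by rewrite /c /d; lra.
have sub : `[al, be] `*` `[c, d] `<=` Omega.
  move=> -[u v] [] /=; rewrite !in_itv/= => /andP[h1 h2] /andP[h3 h4].
  apply: eO; split; rewrite /ball/= ltr_distl; apply/andP; split;
    move: h1 h2 h3 h4; rewrite /al /be /c /d /r; lra.
have HD := weak_form_div_rect _ _ _ _ _ _ _ oO cH cth weak ab cd sub.
set F1 := (fun p => cos _) in HD; set F2 := (fun p => sin _) in HD.
set F3 := clamp2 _ _ _ _ H in HD.
have cth' : continuous (clamp2 al be c d theta) by exact: (continuous_clamp2 Omega).
have c3 : continuous F3 by exact: (continuous_clamp2 Omega).
have c1 : continuous F1.
  by move=> p; apply: continuous_comp; [exact: cth'|exact: continuous_cos].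
have c2 : continuous F2.
  by move=> p; apply: continuous_comp; [exact: cth'|exact: continuous_sin].
have [rr rr0 Hr] : exists2 rr, 0 < rr & forall s, `|s - s0| < rr ->
    [/\ I s, al <= x s <= be & c <= y s <= d].
  have /nbhs_ballP[d1 /= d1p H1] : nbhs s0 I by exact: open_nbhs_nbhs.
  have [d2 d2p H2] := continuous_eps1 _ _ (cx s0 Is0) _ r0.
  have [d3 d3p H3] := continuous_eps1 _ _ (cy s0 Is0) _ r0.
  exists (Num.min d1 (Num.min d2 d3)); first by rewrite !lt_min d1p d2p.
  move=> s; rewrite !lt_min => /andP[h1 /andP[/H2 h2 /H3 h3]]; split.
  - by apply: H1; rewrite /ball/= distrC.
  - move: h2; rewrite ltr_norml /al /be => /andP[? ?]; apply/andP; split; lra.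
  - move: h3; rewrite ltr_norml /c /d => /andP[? ?]; apply/andP; split; lra.
have E1 s : `|s - s0| < rr -> F1 (x s, y s) = cos (theta (x s, y s)).
  by move=> /Hr[_ hx hy]; rewrite /F1 clamp2_id.
have E2 s : `|s - s0| < rr -> F2 (x s, y s) = sin (theta (x s, y s)).
  by move=> /Hr[_ hx hy]; rewrite /F2 clamp2_id.
have ss : `|s0 - s0| < rr by rewrite subrr normr0.
have E3 : F3 (x s0, y s0) = H (x s0, y s0).
  by have [_ hx hy] := Hr s0 ss; rewrite /F3 clamp2_id.
have near_s0 : \forall t \near s0, `|t - s0| < rr.
  by apply/nbhs_ballP; exists rr => // t; rewrite /ball/= distrC.
have U p : F1 p ^+ 2 + F2 p ^+ 2 = 1 by exact: cos2Dsin2.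
have [bx1 bx2] : al < x s0 /\ x s0 < be by rewrite /al /be; split; lra.
have [by1 by2] : c < y s0 /\ y s0 < d by rewrite /c /d; split; lra.
have dc : is_derive s0 1 (fun t => cos (theta (x t, y t)))
    (H (x s0, y s0) * sin (theta (x s0, y s0))).
  have Dxy s : `|s - s0| < rr ->
      is_derive s 1 x (F2 (x s, y s)) /\ is_derive s 1 y (- F1 (x s, y s)).
    by move=> sr; have [Is _ _] := Hr s sr; rewrite E1// E2//; split; [exact: dx|exact: dy].
  have := calibration F1 F2 F3 al be c d c1 c2 c3 U HD x y s0 rr rr0 Dxy bx1 bx2 by1 by2.
  rewrite E3 E2//; apply: near_eq_is_derive.
  by apply: filterS near_s0 => t; exact: E1.
have ds : is_derive s0 1 (fun t => sin (theta (x t, y t)))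
    (- (H (x s0, y s0) * cos (theta (x s0, y s0)))).
  have HD' := div_rect_swap _ _ _ _ _ _ _ c1 c2 c3 HD.
  (* The reflected curve has velocity [(- F1, F2)], the opposite of the characteristic direction of
     the reflected field; reversing the parameter corrects this. *)
  pose u t := y (- t); pose v t := x (- t).
  have U' (p : R * R) : F2 (p.2, p.1) ^+ 2 + F1 (p.2, p.1) ^+ 2 = 1 by rewrite addrC U.
  have Duv s : `|s - - s0| < rr ->
      is_derive s 1 u (F1 (v s, u s)) /\ is_derive s 1 v (- F2 (v s, u s)).
    move=> sr; have sr' : `|- s - s0| < rr by rewrite -normrN opprB opprK addrC -[s0]opprK.
    have [Is _ _] := Hr _ sr'; rewrite /u /v E1// E2//; split.
      by rewrite -[X in is_derive _ _ _ X]opprK; apply: is_derive_reverse; exact: dy.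
    by apply: is_derive_reverse; exact: dx.
  have K := calibration (fun p => F2 (p.2, p.1)) (fun p => F1 (p.2, p.1))
    (fun p => F3 (p.2, p.1)) c d al be (continuous_swap _ c2) (continuous_swap _ c1)
    (continuous_swap _ c3) U' HD' u v (- s0) rr rr0 Duv.
  rewrite /u /v opprK/= in K; have {K} := K by1 by2 bx1 bx2.
  move=> /is_derive_reverse; rewrite E3 E1//; apply: near_eq_is_derive.
  by apply: filterS near_s0 => t; rewrite opprK; exact: E2.
apply: is_derive_angle dc ds.
apply: continuous_for_pair; [exact: cx|exact: cy|].
by apply: cthO; rewrite inE.
Qed.

End Regularity.

(** * Second derivatives and curvature *)

Theorem theoremA (R : realType) (Omega : set (R * R)) (H theta : R * R -> R)
  (hOmega : domain Omega)
  (hH : {within Omega, continuous H})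
  (htheta : {within Omega, continuous theta})
  (hweak : forall phi : R * R -> R, test_function Omega phi ->
    (\int[lebesgue_measure \x lebesgue_measure]_(p in Omega)
        (cos (theta p) * dx phi p + sin (theta p) * dy phi p)%:E
     + \int[lebesgue_measure \x lebesgue_measure]_(p in Omega) (H p * phi p)%:E = 0)%E)
  (I : set R) (x y : R -> R)
  (hGamma : characteristic_curve Omega theta I x y) :
  [/\ C_on 2 I x /\ C_on 2 I y,
      forall s, I s -> curvature x y s = - H (x s, y s) &
      forall s, I s ->
        is_derive s 1 (fun t => theta (x t, y t)) (- H (x s, y s))].
Proof.
have [_ oO _] := hOmega; have [[_ oI _] _ IO ddx ddy] := hGamma.
have dth := characteristic_angle _ _ _ _ _ _ oO hH htheta hweak hGamma.
pose th t := theta (x t, y t); pose h t := H (x t, y t).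
have cH : {in Omega, continuous H} by rewrite -continuous_open_subspace.
have ch s : I s -> {for s, continuous h}.
  move=> Is; apply: continuous_for_pair.
  - exact: is_derive_continuous (ddx s Is).
  - exact: is_derive_continuous (ddy s Is).
  - by apply: cH; rewrite inE; exact: IO.
have cth s : I s -> {for s, continuous th} by move=> /dth;
  exact: is_derive_continuous.
(* Since the angle is differentiable along the curve with continuous derivative [- h], the
   right-hand sides of the curve's equation are C^1 in the parameter. Unit speed then reduces the
   curvature to [- h * (sin ^ 2 + cos ^ 2)]. *)
have dxx s : I s -> is_derive s 1 (fun t => sin (th t)) (cos (th s) * - h s).
  by move=> Is; exact: (@is_derive1_comp R sin th s _ _ (is_derive_sin _) (dth s Is)).
have dyy s : I s -> is_derive s 1 (fun t => - cos (th t)) (- (- sin (th s) * - h s)).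
  move=> Is; apply: is_deriveN.
  exact: (@is_derive1_comp R cos th s _ _ (is_derive_cos _) (dth s Is)).
have cxx s : I s -> {for s, continuous (fun s => cos (th s) * - h s)}.
  move=> Is; apply: cvgM; last exact: cvgN (ch s Is).
  by apply: continuous_comp; [exact: cth|exact: continuous_cos].
have cyy s : I s -> {for s, continuous (fun s => - (- sin (th s) * - h s))}.
  move=> Is; apply: cvgN; apply: cvgM; last exact: cvgN (ch s Is).
  by apply: cvgN; apply: continuous_comp; [exact: cth|exact: continuous_sin].
have [C2x x1 x2] := C_on2_derive _ _ _ _ oI ddx dxx cxx.
have [C2y y1 y2] := C_on2_derive _ _ _ _ oI ddy dyy cyy.
split => // s Is.
rewrite /curvature x1// x2// y1// y2// sqrrN [sin _ ^+ 2 + _]addrC.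
rewrite cos2Dsin2 sqrtr1 expr1n divr1.
rewrite -/(th s) -/(h s) -[RHS]mulr1 -(cos2Dsin2 (th s)); ring.
Qed.
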